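(* Fix $K \in \mathcal{K}$ and $a \geq 0$. Let $Q \in \mathcal{Q}_a$, let $\phi^* := \phi_a^*(Q)$ and let $h^*(r) := p\lambda_p(K) r^{p-1}e^{\phi^*(r)}$ for $r \in [a,\infty)$. (i) The projection is scale equivariant: if $\alpha > 0$ and $Q_\alpha \in \mathcal{Q}_{\alpha a}$ is defined by $Q_\alpha([\alpha a, r)) := Q([a,r/\alpha))$ for all $r \in [\alpha a,\infty)$, then $\phi_{\alpha a}^*(Q_\alpha)(r) = \phi_a^*(Q)(r/\alpha) - p\log\alpha$, and therefore $h^*_{\alpha a}(Q_\alpha)(r) = (1/\alpha) h^*_a(Q)(r/\alpha)$, for $r \in [\alpha a,\infty)$. (ii) Let $\Delta:[a,\infty) \to [-\infty,\infty)$ be a function for which there exists $t > 0$ such that $r \mapsto \phi^*(r) + t\Delta(r)$ belongs to $\Phi_a$. Then $$\int_{[a,\infty)} \Delta\,dQ \leq \int_a^\infty \Delta(r)h^*(r)\,dr.$$ (iii) $\int_a^\infty r h^*(r)\,dr \leq \int_{[a,\infty)} r\,dQ(r)$. (iv) For any $h_0 \in \mathcal{H}_a$, we have $\int_a^\infty h^*\log(h^*/h_0) \leq \int_{[a,\infty)} \log(h^*/h_0)\,dQ$.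
   Context: $\mathcal{K}$ is the set of compact, convex sets $K \subseteq \mathbb{R}^p$ with $0 \in \mathrm{int}(K)$; $\lambda_p$ is Lebesgue measure on $\mathbb{R}^p$. $\Phi$ is the set of upper semi-continuous, concave, decreasing (i.e. non-increasing) functions $\phi:[0,\infty) \to [-\infty,\infty)$, with $e^{-\infty}:=0$, and for $a \geq 0$, $\Phi_a := \{\phi(\cdot - a) : \phi \in \Phi\}$ (functions on $[a,\infty)$). $\mathcal{Q}_a$ is the class of probability measures $Q$ on $[a,\infty)$ with $\int r\,dQ(r) < \infty$ and $Q(\{a\}) < 1$. For $Q \in \mathcal{Q}_a$, $\phi_a^*(Q)$ denotes the unique maximiser over $\phi \in \Phi_a$ of $$L(\phi,Q) := \int_{[a,\infty)} \phi\,dQ - p\lambda_p(K)\int_a^\infty r^{p-1}e^{\phi(r)}\,dr + 1$$ (it exists), and $h_a^*(Q)(r) := p\lambda_p(K) r^{p-1}e^{\phi_a^*(Q)(r)}$, which is a density on $[a,\infty)$. $\mathcal{H}_a$ is the set of functions $r \mapsto p\lambda_p(K) r^{p-1}e^{\phi(r)}$ on $[a,\infty)$ with $\phi \in \Phi_a$ and $p\lambda_p(K)\int_a^\infty r^{p-1}e^{\phi(r)}\,dr = 1$. For $h_0(r) = p\lambda_p(K)r^{p-1}e^{\phi_0(r)} \in \mathcal{H}_a$, the quantity $\log(h^*/h_0)(r)$ is understood as $\phi^*(r) - \phi_0(r)$; integrands multiplied by $h^*$ are taken to be $0$ where $h^* = 0$. *)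

(* Defs.v *)
From HB Require Import structures.
From mathcomp Require Import all_boot all_order all_algebra.
From mathcomp Require Import all_classical all_reals all_analysis.

Set Implicit Arguments.
Unset Strict Implicit.
Unset Printing Implicit Defensive.

Import Order.TTheory GRing.Theory Num.Theory.
Import numFieldNormedType.Exports.

Local Open Scope classical_set_scope.
Local Open Scope ring_scope.
Local Open Scope ereal_scope.

Definition box (R : realType) (p : nat) (l u : 'rV[R]_p) : set 'rV[R]_p :=
  [set x | forall i, (x ord0 i \in `]l ord0 i, u ord0 i])%R].

Definition box_volume (R : realType) (p : nat) (l u : 'rV[R]_p) : R :=
  (\prod_(i < p) Num.max (u ord0 i - l ord0 i) 0)%R.

(* Lebesgue outer measure on R^p (infimum of the total volume over countable
   covers by half-open boxes); it agrees with Lebesgue measure on measurable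
   sets, in particular on compact sets. *)
Definition lebesgue_rV (R : realType) (p : nat) (A : set 'rV[R]_p) : \bar R :=
  ereal_inf [set \sum_(0 <= k <oo) (box_volume (lu k).1 (lu k).2)%:E
    | lu in [set lu : nat -> 'rV[R]_p * 'rV[R]_p |
              A `<=` \bigcup_k box (lu k).1 (lu k).2]].

Definition convex_body0 (R : realType) (p : nat) (K : set 'rV[R]_p) : Prop :=
  [/\ compact K, convex_set K & interior K 0%R].

Definition upper_semicontinuous (R : realType) (X : topologicalType)
    (f : X -> \bar R) : Prop :=
  lower_semicontinuous (fun x => - f x).

(* Functions on [a, +oo[ are represented by functions on the whole of R of
   which only the values on [a, +oo[ matter. *)
Definition Phi (R : realType) (phi : R -> \bar R) : Prop :=
  [/\ (forall r : R, (0 <= r)%R -> phi r < +oo),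
      upper_semicontinuous (phi : subspace `[0%R, +oo[ -> \bar R),
      (forall x y t : R, (0 <= x)%R -> (0 <= y)%R -> (0 <= t <= 1)%R ->
         t%:E * phi x + (1 - t)%:E * phi y <= phi (t * x + (1 - t) * y)%R) &
      (forall x y : R, (0 <= x)%R -> (x <= y)%R -> phi y <= phi x)].

Definition Phi_from (R : realType) (a : R) (psi : R -> \bar R) : Prop :=
  exists2 phi : R -> \bar R, Phi phi &
    forall r : R, (a <= r)%R -> psi r = phi (r - a)%R.

Definition Qclass (R : realType) (a : R)
    (Q : probability (measurableTypeR R) R) : Prop :=
  [/\ Q `[a, +oo[%classic = 1, \int[Q]_(r in `[a, +oo[) r%:E < +oo & Q [set a] < 1].

(* expeR -oo = 0, and x * 0 = 0 for every x in \bar R: a product with this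
   function vanishes wherever the function does, even against an infinite factor. *)
Definition radial (R : realType) (p : nat) (K : set 'rV[R]_p)
    (phi : R -> \bar R) (r : R) : \bar R :=
  p%:R%:E * lebesgue_rV K * (r ^+ p.-1)%:E * expeR (phi r).

Definition Lfun (R : realType) (p : nat) (K : set 'rV[R]_p) (a : R)
    (phi : R -> \bar R) (Q : probability (measurableTypeR R) R) : \bar R :=
  \int[Q]_(r in `[a, +oo[) phi r
  - p%:R%:E * lebesgue_rV K *
      \int[lebesgue_measure]_(r in `[a, +oo[) ((r ^+ p.-1)%:E * expeR (phi r))
  + 1.

(* phi is the unique maximiser of L(., Q) over Phi_a, uniqueness being that of
   functions on [a, +oo[. *)
Definition is_phi_star (R : realType) (p : nat) (K : set 'rV[R]_p) (a : R)
    (Q : probability (measurableTypeR R) R) (phi : R -> \bar R) : Prop :=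
  [/\ Phi_from a phi,
      (forall psi, Phi_from a psi -> Lfun K a psi Q <= Lfun K a phi Q) &
      (forall psi, Phi_from a psi -> Lfun K a psi Q = Lfun K a phi Q ->
         forall r : R, (a <= r)%R -> psi r = phi r)].

Definition Hclass (R : realType) (p : nat) (K : set 'rV[R]_p) (a : R)
    (h : R -> \bar R) : Prop :=
  exists phi : R -> \bar R,
    [/\ Phi_from a phi,
        (forall r : R, (a <= r)%R -> h r = radial K phi r) &
        p%:R%:E * lebesgue_rV K *
          \int[lebesgue_measure]_(r in `[a, +oo[)
             ((r ^+ p.-1)%:E * expeR (phi r)) = 1].

(* Main.v *)
Require Import Defs.
From HB Require Import structures.
From mathcomp Require Import all_boot all_order all_algebra.
From mathcomp Require Import all_classical all_reals all_analysis.
From mathcomp Require Import measurable_realfun simple_functions.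
From mathcomp Require Import exponential_distribution ring lra.

Set Implicit Arguments.
Unset Strict Implicit.
Unset Printing Implicit Defensive.

Import Order.TTheory GRing.Theory Num.Theory.
Import numFieldNormedType.Exports.

Local Open Scope classical_set_scope.
Local Open Scope ring_scope.
Local Open Scope ereal_scope.

(** The projection is characterised by its first-order condition.  If
    [phi* + t Delta] is admissible then so is [phi* + s Delta] for [0 <= s <= t]
    by concavity, and [L (phi* + s Delta) <= L phi*] rearranges to

      int Delta dQ <= int h* (exp (s Delta) - 1) / s.

    Letting [s] tend to 0 gives (ii).  The passage to the limit is Fatou's lemma,
    with dominating function [h* exp (u Delta)], [u = t / 2]; it is integrable
    because [phi*] is concave and not constant, hence lies below an affine
    function with negative slope.  Part (iii) is [Delta = - r], part (iv) is
    [Delta = phi0 - phi*], and (i) is the change of variables [r -> alpha r]. *)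

(** * Integration of quasi-integrable functions *)

(** The integral of [Delta] against [Q] may be [-oo], so additivity is used with only the positive
    parts integrable. The difference quotients are controlled on one side only: for real [y], [(m +
    1) * (exp (y / (m + 1)) - 1) <= exp y], whereas they tend to [-oo] where [Delta = -oo] and the
    density is positive. This is why Fatou's lemma is applied to the nonnegative gap below the
    dominating function. The step [u] stays strictly below [t] because the function at step [t] is
    only known to be bounded above and its radial integral may be infinite; at step [u] a positive
    share of the decaying maximiser remains. Finiteness of both integrals of the maximiser, on which
    all cancellations rest, comes from a competitor at which the functional is finite. *)

Section integral_lemmas.
Context d (T : measurableType d) (R : realType).
Variables (mu : {measure set T -> \bar R}) (D : set T) (mD : measurable D).
Implicit Types f g : T -> \bar R.

Lemma integrable_posneg f : measurable_fun D f ->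
  \int[mu]_(x in D) f^\+ x < +oo -> \int[mu]_(x in D) f^\- x < +oo ->
  mu.-integrable D f.
Proof.
move=> mf fp fn; apply/integrableP; split => //.
under eq_integral do rewrite -/((abse \o f) _) fune_abse.
rewrite ge0_integralD//; [exact: lte_add_pinfty| |];
  [exact: measurable_funepos|exact: measurable_funeneg].
Qed.

Lemma integral_pos_neNy f : \int[mu]_(x in D) f^\+ x < +oo ->
  -oo < \int[mu]_(x in D) f x -> \int[mu]_(x in D) f^\- x < +oo.
Proof.
move=> fp; rewrite integralE => h; rewrite ltNge; apply/negP.
by rewrite leye_eq => /eqP E; move: h; rewrite E addeNy ltxx.
Qed.

(** Contrapositive of integrating [f^- <= (f + g)^- + g^+], an inequality that survives infinite
    values. *)
Lemma integral_negDy f g : measurable_fun D f -> measurable_fun D g ->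
  \int[mu]_(x in D) g^\+ x < +oo -> \int[mu]_(x in D) f^\- x = +oo ->
  \int[mu]_(x in D) (f \+ g)^\- x = +oo.
Proof.
move=> mf mg gp fn; apply/eqP; rewrite -leye_eq leNgt; apply/negP => fgn.
have : \int[mu]_(x in D) f^\- x
         <= \int[mu]_(x in D) ((f \+ g)^\- x + g^\+ x).
  apply: ge0_le_integral => //.
  - exact: measurable_funeneg.
  - apply: emeasurable_funD; last exact: measurable_funepos.
    by apply: measurable_funeneg; exact: emeasurable_funD.
  - move=> x Dx; rewrite funeposE !funenegE ge_max; apply/andP; split; last first.
      by rewrite adde_ge0// le_max lexx orbT.
    have h (u v w : \bar R) : u <= v + w -> u <= maxe v 0 + maxe w 0.
      by move=> /le_trans; apply; apply: leeD; rewrite le_max lexx.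
    case: (g x) => [s| |]; last 1 first.
    + by rewrite addeNy /= [maxe +oo 0]max_l// addye ?leey// gt_eqF// lt_max ltNy0 orbT.
    + apply: h => /=; case: (f x) => [r| |]//=; idtac.
      by rewrite -EFinD lee_fin opprD addrNK.
    + by rewrite [maxe +oo 0]max_l // addey ?leey // gt_eqF // lt_max ltNy0 orbT.
rewrite fn leye_eq ge0_integralD//.
- by rewrite lt_eqF// lte_add_pinfty.
- by apply: measurable_funeneg; exact: emeasurable_funD.
- exact: measurable_funepos.
Qed.

(** If one negative part has infinite integral, both sides are [-oo]; otherwise both functions are
    integrable. *)
Lemma integralD_pos f g : measurable_fun D f -> measurable_fun D g ->
  \int[mu]_(x in D) f^\+ x < +oo -> \int[mu]_(x in D) g^\+ x < +oo ->
  \int[mu]_(x in D) (f x + g x)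
    = \int[mu]_(x in D) f x + \int[mu]_(x in D) g x.
Proof.
move=> mf mg fp gp.
have [fn|] := ltP (\int[mu]_(x in D) f^\- x) +oo; last first.
  rewrite leye_eq => /eqP fn.
  rewrite -[LHS]/(\int[mu]_(x in D) (f \+ g) x) integralE.
  by rewrite (integral_negDy mf mg gp)// addeNy (integralE _ _ f) fn addeNy.
have [gn|] := ltP (\int[mu]_(x in D) g^\- x) +oo; last first.
  rewrite leye_eq => /eqP gn; under eq_integral do rewrite addeC.
  rewrite -[LHS]/(\int[mu]_(x in D) (g \+ f) x) integralE.
  by rewrite (integral_negDy mg mf fp)// addeNy (integralE _ _ g) gn !addeNy.
by rewrite integralD//; exact: integrable_posneg.
Qed.

Import HBNNSimple.

(** The integral is a supremum over simple functions below [f]. Multiplying one by the indicator of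
    the complement of [N] keeps its integral and places it below [f] restricted to that
    complement. *)
Lemma ge0_integral_null_setD (N : set T) f : measurable N -> mu N = 0 ->
  (forall x, D x -> 0 <= f x) ->
  \int[mu]_(x in D) f x = \int[mu]_(x in D `\` N) f x.
Proof.
move=> mN N0 f0; have f0' x : (D `\` N) x -> 0 <= f x by move=> [/f0].
apply/eqP; rewrite eq_le; apply/andP; split; rewrite !ge0_integralE//.
  apply: ge_ereal_sup => _ [h /= hf <-].
  have mNC : measurable (~` N) by exact: measurableC.
  rewrite -(integralT_nnsfun mu h).
  rewrite (ge0_negligible_integral mN)//; last 2 first.
  - exact/measurable_EFinP.
  - by move=> x _; rewrite lee_fin.
  rewrite setTD integral_nnsfun//; apply: ereal_sup_ubound => /=.
  exists (proj_nnsfun h mNC); last by rewrite mrestrict.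
  move=> x; rewrite /= mindicE.
  have [xN|xN] := pselect (N x).
    have -> : (x \in ~` N) = false by apply/memNset => /(_ xN).
    by rewrite mulr0; exact: erestrict_ge0.
  rewrite mem_set //= mulr1 (le_trans (hf x))// !patchE.
  have [xD|xD] := pselect (D x); first by rewrite !mem_set.
  by rewrite (memNset xD); case: ifPn => //; rewrite inE => -[/xD].
apply: ereal_sup_le => _ [h /= hf <-]; exists h => //.
move=> x; rewrite (le_trans (hf x))// !patchE.
case: ifPn => [|_]; first by rewrite inE => -[/mem_set -> _].
by case: ifPn => //; rewrite inE => /f0.
Qed.

(* No measurability is assumed of [f]: in part (ii) nothing is known about
   [Delta] where [phi_star] is [-oo]. *)
Lemma integral_null_setD (N : set T) f : measurable N -> mu N = 0 ->
  \int[mu]_(x in D) f x = \int[mu]_(x in D `\` N) f x.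
Proof.
move=> mN N0; rewrite integralE [RHS]integralE.
by congr (_ - _); exact: ge0_integral_null_setD.
Qed.

End integral_lemmas.

(** * Admissible functions *)

(* [Phi_from a], rephrased on [a, +oo[ itself (see [Phi_fromP]). *)
Definition phi_on (R : realType) (a : R) (psi : R -> \bar R) : Prop :=
  [/\ (forall r : R, (a <= r)%R -> psi r < +oo),
      (forall x y : R, (a <= x)%R -> psi x < y%:E -> exists2 e : R, (0 < e)%R &
         forall z : R, (a <= z)%R -> (`|x - z| < e)%R -> psi z < y%:E),
      (forall x y t : R, (a <= x)%R -> (a <= y)%R -> (0 <= t <= 1)%R ->
         t%:E * psi x + (1 - t)%:E * psi y <= psi (t * x + (1 - t) * y)%R) &
      (forall x y : R, (a <= x)%R -> (x <= y)%R -> psi y <= psi x)].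

Section phi_on_theory.
Variable R : realType.
Implicit Types (a k x y t : R) (psi : R -> \bar R).

Lemma nbhs_subspace_itvcy a x (V : set R) : (a <= x)%R ->
  nbhs (x : subspace `[a, +oo[) V <->
  exists2 e : R, (0 < e)%R &
    forall z : R, (a <= z)%R -> (`|x - z| < e)%R -> V z.
Proof.
move=> ax; have xA : `[a, +oo[%classic x by rewrite /= in_itv /= andbT.
rewrite /nbhs /= -(nbhs_subspace_in xA) /=; split=> -[e /= e0 eV]; exists e => //=.
  by move=> z az xz; apply: eV => //; rewrite /= in_itv /= andbT.
by move=> z /= xz; rewrite in_itv /= andbT => az; exact: eV.
Qed.

(** In the subspace topology a point outside the subset is isolated, so upper semicontinuity on [[0,
    +oo[] asks nothing at negative arguments. *)
Lemma nbhs_subspace_itvcy_out a x : (x < a)%R ->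
  nbhs (x : subspace `[a, +oo[) [set x].
Proof.
move=> xa; have xA : ~ `[a, +oo[%classic x.
  by rewrite /= in_itv /= andbT => /(lt_le_trans xa); rewrite ltxx.
by rewrite /nbhs /= -(nbhs_subspace_out xA) => z.
Qed.

Lemma Phi_fromP a psi : Phi_from a psi <-> phi_on a psi.
Proof.
split.
  move=> [phi [h1 h2 h3 h4] e].
  have s0 r : (a <= r)%R -> (0 <= r - a)%R by rewrite subr_ge0.
  split.
  - by move=> r ar; rewrite e// h1// s0.
  - move=> x y ax; rewrite e// => xy.
    have := h2 (x - a)%R (- y)%R; rewrite EFinN lteN2 => /(_ xy)[V].
    move=> /(nbhs_subspace_itvcy _ (s0 _ ax))[r r0 rV] VP.
    exists r => // z az xz; rewrite e// -lteN2; apply: (VP (z - a)%R).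
    by apply: rV; [exact: s0|rewrite opprB addrA subrK].
  - move=> x y t ax ay t01; have /andP[t0 t1] := t01.
    have axy : (a <= t * x + (1 - t) * y)%R.
      rewrite -[leLHS](_ : (t * a + (1 - t) * a = a)%R); last by ring.
      by apply: lerD; apply: ler_wpM2l => //; rewrite subr_ge0.
    rewrite !e//.
    rewrite (_ : t * x + (1 - t) * y - a
        = t * (x - a) + (1 - t) * (y - a))%R; last by ring.
    by apply: h3 => //; exact: s0.
  - move=> x y ax xy; rewrite !e ?(le_trans ax)//; apply: h4; first exact: s0.
    by rewrite lerB.
move=> [h1 h2 h3 h4]; have a0 r : (0 <= r)%R -> (a <= r + a)%R by rewrite lerDr.
exists (fun r => psi (r + a)%R) => [|r ar]; last by rewrite subrK.
split.
- by move=> r r0; apply: h1; exact: a0.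
- move=> x y; rewrite lteNr -EFinN => xy.
  have [x0|x0] := leP 0%R x.
    have [e e0 H] := h2 _ _ (a0 _ x0) xy.
    exists [set z | psi (z + a)%R < (- y)%:E]; last first.
      by move=> z /= ?; rewrite lteNr.
    apply/nbhs_subspace_itvcy => //; exists e => // z z0 xz /=.
    by apply: H; [exact: a0|rewrite opprD addrACA subrr addr0].
  exists [set x]; first exact: nbhs_subspace_itvcy_out.
  by move=> z ->; rewrite lteNr.
- move=> x y t x0 y0 t01.
  rewrite (_ : t * x + (1 - t) * y + a = t * (x + a) + (1 - t) * (y + a))%R; last by ring.
  by apply: h3 => //; exact: a0.
- by move=> x y x0 xy; apply: h4; [exact: a0|rewrite lerD2r].
Qed.

Lemma phi_onD a psi1 psi2 : phi_on a psi1 -> phi_on a psi2 ->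
  phi_on a (fun r => psi1 r + psi2 r).
Proof.
move=> [f1 f2 f3 f4] [g1 g2 g3 g4]; split.
- by move=> r ar; rewrite lte_add_pinfty ?f1 ?g1.
- move=> x y ax xy.
  (* The slack below [y] is halved between two finite values; if only one value is [-oo], its
     threshold absorbs whatever the other leaves. *)
  have [y1 [y2 [fy1 gy2 y12]]] : exists y1 y2 : R,
      [/\ psi1 x < y1%:E, psi2 x < y2%:E & (y1 + y2 <= y)%R].
    move: (f1 _ ax) (g1 _ ax) xy.
    move: (psi1 x) (psi2 x) => [r| |] [s| |]// _ _.
    + rewrite -EFinD !lte_fin => rsy.
      exists (r + (y - (r + s)) / 2)%R, (s + (y - (r + s)) / 2)%R.
      by rewrite !lte_fin; split; lra.
    + exists (r + 1)%R, (y - r - 1)%R; rewrite ltNyr lte_fin.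
      by split => //; lra.
    + exists (y - s - 1)%R, (s + 1)%R; rewrite ltNyr lte_fin.
      by split => //; lra.
    + by exists y, 0%R; rewrite !ltNyr addr0.
  have [e e0 He] := f2 _ _ ax fy1; have [d d0 Hd] := g2 _ _ ax gy2.
  exists (Num.min e d) => [|z az]; first by rewrite lt_min e0.
  rewrite lt_min => /andP[ze zd].
  rewrite (lt_le_trans (lteD (He _ az ze) (Hd _ az zd)))//.
- move=> x y t ax ay t01; have /andP[t0 t1] := t01.
  have dd r : (a <= r)%R -> psi1 r +? psi2 r.
    by move=> ar; rewrite ltpinfty_adde_def// inE ?f1 ?g1.
  rewrite !muleDr// ?dd// addeACA; apply: leeD; [exact: f3|exact: g3].
- by move=> x y ax xy; apply: leeD; [exact: f4|exact: g4].
Qed.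

Lemma phi_onZ a k psi : (0 <= k)%R -> phi_on a psi ->
  phi_on a (fun r => k%:E * psi r).
Proof.
(* For [k = 0] the product is the zero function, since [0 * -oo = 0]: the domain of [psi] is
   forgotten. *)
rewrite le_eqVlt => /predU1P[<- _|k0 [f1 f2 f3 f4]].
  under [fun r => _]funext do rewrite mul0e.
  split => [r _|x y _ y0|x y t _ _ _|x y _ _] //.
    by exists 1%R.
  by rewrite !mule0 adde0.
split.
- by move=> r ar; have := f1 _ ar; case: (psi r) => [s| |]// _;
    rewrite ?ltry// gt0_muleNy.
- move=> x y ax; rewrite -lte_pdivlMl// -EFinM => /(f2 _ _ ax)[e e0 H].
  by exists e => // z az xz; rewrite -lte_pdivlMl// -EFinM; exact: H.
- move=> x y t ax ay t01; have /andP[t0 t1] := t01.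
  rewrite muleCA [X in _ + X]muleCA -muleDr//.
    by rewrite lee_pmul2l//; exact: f3.
  have lty s r : (0 <= s)%R -> (a <= r)%R -> s%:E * psi r < +oo.
    move=> s0 ar; have := f1 _ ar; case: (psi r) => [u| |]// _; rewrite ?ltry//.
    rewrite mulrNy; move: s0; rewrite le_eqVlt => /predU1P[<-|s0].
      by rewrite sgr0 mul0e.
    by rewrite gtr0_sg// mul1e.
  by rewrite ltpinfty_adde_def// inE lty// subr_ge0.
- by move=> x y ax xy; rewrite lee_pmul2l//; exact: f4.
Qed.

Lemma phi_on_affine a (b k : R) : (0 <= k)%R ->
  phi_on a (fun r => (b - k * r)%:E).
Proof.
move=> k0; split.
- by move=> r _; exact: ltry.
- move=> x y ax; rewrite lte_fin => xy.
  have k1 : (0 < k + 1)%R by rewrite ltr_wpDl.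
  (* Dividing by [k + 1] instead of [k] covers [k = 0]. *)
  exists ((y - (b - k * x)) / (k + 1))%R; first by rewrite divr_gt0 ?subr_gt0.
  move=> z az; rewrite ltr_pdivlMr// lte_fin => h.
  have h1 : (x - z <= `|x - z|)%R by exact: ler_norm.
  have h2 : (k * (x - z) <= k * `|x - z|)%R by rewrite ler_wpM2l.
  have h3 : (0 <= `|x - z|)%R by [].
  by lra.
- by move=> x y t _ _ _; rewrite -!EFinM -EFinD lee_fin; lra.
- by move=> x y _ xy; rewrite lee_fin lerB// ler_wpM2l.
Qed.

Lemma phi_on_scale a k psi : (0 < k)%R -> phi_on a psi ->
  phi_on (a / k) (fun r => psi (k * r)%R).
Proof.
move=> k0 [f1 f2 f3 f4]; have ak r : (a / k <= r)%R -> (a <= k * r)%R.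
  by rewrite ler_pdivrMr// mulrC.
split.
- by move=> r /ak; exact: f1.
- move=> x y /ak ax /(f2 _ _ ax)[e e0 H]; exists (e / k)%R; first exact: divr_gt0.
  move=> z /ak az; rewrite ltr_pdivlMr// => xz; apply: H => //.
  by rewrite -mulrBr normrM gtr0_norm// mulrC.
- move=> x y t /ak ax /ak ay t01.
  rewrite (_ : k * (t * x + (1 - t) * y)
      = t * (k * x) + (1 - t) * (k * y))%R; last by ring.
  exact: f3.
- by move=> x y /ak ax xy; apply: f4; rewrite ?ler_pM2l.
Qed.

Lemma eq_phi_on a psi1 psi2 : (forall r, (a <= r)%R -> psi1 r = psi2 r) ->
  phi_on a psi1 -> phi_on a psi2.
Proof.
move=> e /Phi_fromP[phi Pphi phiE]; apply/Phi_fromP; exists phi => // r ar.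
by rewrite -e// phiE.
Qed.

(** By monotonicity, preimages of open upper rays are intervals. *)
Lemma emeasurable_nonincreasing a psi :
  (forall x y, (a <= x)%R -> (x <= y)%R -> psi y <= psi x) ->
  measurable_fun `[a, +oo[%classic psi.
Proof.
move=> f4; apply: (measurability _ (ErealGenOInfty.measurableE R)).
move=> /= _ [_ [y ->]] <-; apply: is_interval_measurable.
rewrite preimage_itvoy => s t /= []; rewrite in_itv/= andbT => as_ ys [].
rewrite in_itv/= andbT => at_ yt u /andP[su ut].
have au := le_trans as_ su.
by split; rewrite ?in_itv/= ?andbT// (lt_le_trans yt)// f4.
Qed.

Lemma measurable_phi_on a psi : phi_on a psi ->
  measurable_fun `[a, +oo[%classic psi.
Proof. by move=> [_ _ _ f4]; exact: emeasurable_nonincreasing. Qed.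

End phi_on_theory.

(** * Dilations *)

Section scaling.
Variable R : realType.
Local Notation mu := (@lebesgue_measure R).
Implicit Types (a k : R).

Definition dilation k (x : measurableTypeR R) : measurableTypeR R := (k * x)%R.

Lemma measurable_dilation k : measurable_fun setT (dilation k).
Proof. exact: mulrl_measurable. Qed.

HB.instance Definition _ k :=
  isMeasurableFun.Build _ _ _ _ (dilation k) (measurable_dilation k).

Lemma dilation_preimage_itvcy k a : (0 < k)%R ->
  dilation k @^-1` `[a, +oo[%classic = `[(a / k)%R, +oo[%classic.
Proof.
move=> k0; apply/seteqP; split => x /=; rewrite !in_itv/= !andbT /dilation;
  by rewrite ler_pdivrMr// mulrC.
Qed.

(** Both sides agree on the intervals []x, y]], which determine Lebesgue measure. *)
Lemma lebesgue_measure_dilation k (k0 : (0 < k)%R) (A : set R) : measurable A ->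
  mu A = k%:E * pushforward mu (dilation k) A.
Proof.
pose kn : {nonneg R} := NngNum (ltW k0).
move=> mA.
rewrite (@lebesgue_measure_unique R (mscale kn (pushforward mu (dilation k))))//.
move=> _ [[x y]] /= xy <-.
have E : dilation k @^-1` `]x, y]%classic = `](x / k)%R, (y / k)%R]%classic.
  apply/seteqP; split => z /=; rewrite !in_itv/= /dilation;
  by rewrite ltr_pdivrMr// ler_pdivlMr// [(z * k)%R]mulrC.
transitivity (k%:E * mu `](x / k)%R, (y / k)%R]%classic); last by rewrite -E.
rewrite !lebesgue_measure_itv/= !lte_fin ltr_pM2r ?invr_gt0//.
case: ifPn => _; last by rewrite mule0.
by rewrite -!EFinD -EFinM -mulrBl mulrC divfK// gt_eqF.
Qed.

Lemma ge0_integral_lebesgue_dilation k a (f : R -> \bar R) : (0 < k)%R ->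
  measurable_fun `[a, +oo[%classic f ->
  (forall x, (a <= x)%R -> 0 <= f x) ->
  \int[mu]_(x in `[a, +oo[) f x
    = k%:E * \int[mu]_(x in `[(a / k)%R, +oo[) f (k * x)%R.
Proof.
move=> k0 mf f0; pose kn : {nonneg R} := NngNum (ltW k0).
rewrite (eq_measure_integral (mscale kn (pushforward mu (dilation k)))); last first.
  by move=> A mA _; exact: lebesgue_measure_dilation.
rewrite ge0_integral_mscale//; last first.
  by move=> x /=; rewrite in_itv/= andbT => /f0.
rewrite ge0_integral_pushforward//.
  by rewrite dilation_preimage_itvcy.
by move=> x; rewrite inE /= in_itv/= andbT => /f0.
Qed.

Lemma probability_itvNyo_eq0 a (P : probability (measurableTypeR R) R) x :
  P `[a, +oo[%classic = 1 -> (x <= a)%R -> P `]-oo, x[%classic = 0.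
Proof.
move=> Pa xa; apply/eqP; rewrite -measure_le0.
have -> : 0 = P (~` `[a, +oo[%classic) :> \bar R.
  by rewrite probability_setC// Pa subee.
apply: le_measure; rewrite ?inE//; first exact: measurableC.
move=> z /=; rewrite !in_itv/= andbT => zx; apply/negP.
by rewrite -ltNge (lt_le_trans zx).
Qed.

Lemma probability_itvNyo a (P : probability (measurableTypeR R) R) x :
  P `[a, +oo[%classic = 1 -> (a <= x)%R ->
  P `]-oo, x[%classic = P `[a, x[%classic.
Proof.
move=> Pa ax.
have -> : `]-oo, x[%classic = `]-oo, a[%classic `|` `[a, x[%classic.
  apply/seteqP; split => z /=; rewrite !in_itv/=.
    by move=> zx; have [za|az] := ltP z a; [left|right].
  by case=> [/lt_le_trans|/andP[]//]; apply.
rewrite measureU//; last first.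
  apply/seteqP; split => z //= -[]; rewrite !in_itv/= => za /andP[].
  by move=> /(lt_le_trans za); rewrite ltxx.
by rewrite [X in X + _](_ : _ = 0) ?add0e//; exact: (probability_itvNyo_eq0 Pa (lexx a)).
Qed.

(* Half-open intervals starting at [k * a] do not cover the line, so first
   [P `[k * a, +oo[ = 1] is recovered by continuity from below. *)
Lemma probability_dilation k a (P Q : probability (measurableTypeR R) R) :
  (0 < k)%R -> Q `[a, +oo[%classic = 1 ->
  (forall r, (k * a <= r)%R ->
     P `[(k * a)%R, r[%classic = Q `[a, (r / k)%R[%classic) ->
  forall A, measurable A -> P A = pushforward Q (dilation k) A.
Proof.
move=> k0 Qa PQ A mA.
have kaE : (k * a / k = a)%R by rewrite mulrAC divff ?gt_eqF// mul1r.
have Pa : P `[(k * a)%R, +oo[%classic = 1.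
  pose F n := `[(k * a)%R, (k * a + n%:R)%R[%classic : set (measurableTypeR R).
  pose G n := `[a, ((k * a + n%:R) / k)%R[%classic : set (measurableTypeR R).
  have ndF : nondecreasing_seq F.
    move=> m n mn; apply/subsetPset => z; rewrite /F /= !in_itv/= => /andP[-> zm].
    by rewrite (lt_le_trans zm)// lerD2l ler_nat.
  have ndG : nondecreasing_seq G.
    move=> m n mn; apply/subsetPset => z; rewrite /G /= !in_itv/= => /andP[-> zm].
    by rewrite (lt_le_trans zm)// ler_pM2r ?invr_gt0// lerD2l ler_nat.
  have FU : \bigcup_n F n = `[(k * a)%R, +oo[%classic.
    apply/seteqP; split => z /=; rewrite in_itv/= andbT.
      by move=> [n _]; rewrite /F/= in_itv/= => /andP[].
    move=> az; exists (Num.truncn (z - k * a)).+1 => //; rewrite /F/= in_itv/= az.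
    by rewrite addrC -ltrBlDr truncnS_gt.
  have GU : \bigcup_n G n = `[a, +oo[%classic.
    apply/seteqP; split => z /=; rewrite in_itv/= andbT.
      by move=> [n _]; rewrite /G/= in_itv/= => /andP[].
    move=> az; exists (Num.truncn (k * z - k * a)).+1 => //; rewrite /G/= in_itv/= az.
    by rewrite ltr_pdivlMr// addrC -ltrBlDr mulrC truncnS_gt.
  rewrite -Qa -FU -GU.
  have hF : P (F n) @[n --> \oo] --> P (\bigcup_n F n).
    apply: nondecreasing_cvg_mu => // [n|]; first exact: measurable_itv.
    by apply: bigcupT_measurable => n; exact: measurable_itv.
  have hG : Q (G n) @[n --> \oo] --> Q (\bigcup_n G n).
    apply: nondecreasing_cvg_mu => // [n|]; first exact: measurable_itv.
    by apply: bigcupT_measurable => n; exact: measurable_itv.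
  have E : (fun n => Q (G n)) = (fun n => P (F n)).
    by apply/funext => n; rewrite /F PQ// lerDl.
  by move: hG; rewrite E => hG; exact: (cvg_unique _ hF hG).
pose G n := `]-oo, n%:R[%classic : set (measurableTypeR R).
apply: (@measure_unique _ R (measurableTypeR R) (@RGenInftyO.G R) G _ _ _ _
  P (pushforward Q (dilation k))) => //.
- exact: RGenInftyO.measurableE.
- move=> _ _ [x ->] [y ->]; exists (Num.min x y).
  by apply/seteqP; split => z /=; rewrite !in_itv/= lt_min => /andP.
- by move=> n; exists n%:R.
- apply/seteqP; split => z // _; exists (Num.truncn z).+1 => //.
  by rewrite /G /= in_itv/= truncnS_gt.
- move=> _ [x ->].
  have E : dilation k @^-1` `]-oo, x[%classic = `]-oo, (x / k)%R[%classic.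
    by apply/seteqP; split => z /=; rewrite !in_itv/= ltr_pdivlMr// mulrC.
  suff : P `]-oo, x[%classic = Q `]-oo, (x / k)%R[%classic by rewrite -E.
  have [kax|xka] := leP (k * a)%R x.
    rewrite (probability_itvNyo Pa kax) PQ//; apply/esym.
    by apply: (probability_itvNyo Qa); rewrite ler_pdivlMr// mulrC.
  rewrite (probability_itvNyo_eq0 Pa (ltW xka)); apply/esym.
  by apply: (probability_itvNyo_eq0 Qa); rewrite ler_pdivrMr// mulrC ltW.
- by move=> n; rewrite ltey_eq fin_num_measure//; exact: measurable_itv.
Qed.

End scaling.

(** * Exponential decay of admissible functions *)

Section radial_integral.
Variable R : realType.
Local Notation mu := (@lebesgue_measure R).
Implicit Types (a b k r : R) (n : nat) (psi : R -> \bar R).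

(** The exponent [n] stands for [p - 1]; the factor [p * lebesgue_rV K] is kept apart as a real
    constant [c]. *)
Definition radial_int n a psi : \bar R :=
  \int[mu]_(r in `[a, +oo[) ((r ^+ n)%:E * expeR (psi r)).

(** A single term of the exponential series. *)
Lemma expR_ge_power n r : (0 <= r)%R -> (r ^+ n <= n`!%:R * expR r)%R.
Proof.
case: n => [|n] r0; first by rewrite expr0 fact0 mul1r -expR0 ler_expR.
have n0 : (0 < n.+1`!%:R :> R)%R by rewrite ltr0n fact_gt0.
rewrite -ler_pdivrMl// mulrC (le_trans _ (expR_ge1Dxn n r0))//.
by rewrite lerDr.
Qed.

Lemma measurable_power_expR n b k D :
  measurable_fun D (fun r => (r ^+ n * expR (b - k * r))%R).
Proof.
apply: measurable_funM; first exact: exprn_measurable.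
apply: measurableT_comp => //; apply: measurable_funB => //.
Qed.

Lemma integral_power_expR_lty n a b k : (0 <= a)%R -> (0 < k)%R ->
  \int[mu]_(r in `[a, +oo[) (r ^+ n * expR (b - k * r))%:E < +oo.
Proof.
move=> a0 k0; have k20 : (0 < k / 2)%R by rewrite divr_gt0.
(* Half of the rate [k] absorbs [r ^+ n], at the cost of the factorial over [(k / 2) ^+ n]. The
   other half leaves the exponential density of rate [k / 2], whose normalising factor is divided
   out. *)
pose C := (n`!%:R / (k / 2) ^+ n * expR b / (k / 2))%R.
have C0 : (0 <= C)%R by rewrite !mulr_ge0 ?invr_ge0 ?exprn_ge0 ?expR_ge0// ltW.
have mpdf D : measurable_fun D (EFin \o exponential_pdf (k / 2)).
  apply: measurable_funTS; apply/measurable_EFinP.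
  exact: measurable_exponential_pdf.
have pdf0 x : 0 <= (exponential_pdf (k / 2) x)%:E.
  by rewrite lee_fin exponential_pdf_ge0// ltW.
apply: (@le_lt_trans _ _ (C%:E * \int[mu]_r (exponential_pdf (k / 2) r)%:E)).
  rewrite -ge0_integralZl//; last exact: mpdf.
  apply: (@le_trans _ _ (\int[mu]_(r in `[a, +oo[)
      (C%:E * (exponential_pdf (k / 2) r)%:E))).
    apply: ge0_le_integral => //.
    - move=> r; rewrite /= in_itv/= andbT => ar.
      by rewrite lee_fin mulr_ge0 ?expR_ge0// exprn_ge0// (le_trans a0).
    - by apply/measurable_EFinP; exact: measurable_power_expR.
    - by apply: measurable_funeM; exact: mpdf.
    - move=> r; rewrite /= in_itv/= andbT => ar.
      have r0 := le_trans a0 ar.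
      rewrite -EFinM lee_fin exponential_pdfE//.
      have h := expR_ge_power n (mulr_ge0 (ltW k20) r0).
      rewrite exprMn -ler_pdivlMl ?exprn_gt0// in h.
      have e0 := expR_ge0 (b - k * r).
      apply: (le_trans (ler_wpM2r e0 h)).
      rewrite /C le_eqVlt; apply/orP; left; apply/eqP.
      rewrite (_ : b - k * r = b + (- (k / 2) * r) + - (k / 2 * r))%R; last by field.
      rewrite 2!expRD expRN; field.
      by rewrite !gt_eqF ?expR_gt0 ?exprn_gt0.
  apply: ge0_subset_integral => //.
  - by apply: measurable_funeM; exact: mpdf.
  - by move=> r _; rewrite mule_ge0.
by rewrite integral_exponential_pdf// mule1 ltry.
Qed.

Lemma measurable_radial n a psi : phi_on a psi ->
  measurable_fun `[a, +oo[%classic (fun r => (r ^+ n)%:E * expeR (psi r)).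
Proof.
move=> hpsi; apply: emeasurable_funM.
  by apply/measurable_EFinP; exact: exprn_measurable.
have [_ _ _ f4] := hpsi.
by apply: emeasurable_nonincreasing => x y ax xy; rewrite lee_expeR f4.
Qed.

Lemma radial_int_lty n a b k psi : (0 <= a)%R -> (0 < k)%R -> phi_on a psi ->
  (forall r, (a <= r)%R -> psi r <= (b - k * r)%:E) -> radial_int n a psi < +oo.
Proof.
move=> a0 k0 hpsi psib.
apply: le_lt_trans (integral_power_expR_lty n b a0 k0).
apply: ge0_le_integral => //.
- move=> r; rewrite /= in_itv/= andbT => ar.
  by rewrite mule_ge0 ?expeR_ge0// lee_fin exprn_ge0// (le_trans a0).
- exact: measurable_radial.
- by apply/measurable_EFinP; exact: measurable_power_expR.
- move=> r; rewrite /= in_itv/= andbT => ar.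
  rewrite EFinM lee_wpmul2l// ?lee_fin ?exprn_ge0// ?(le_trans a0)//.
  by rewrite -[leRHS]/(expeR (b - k * r)%:E) lee_expeR psib.
Qed.

(** Beyond [r1], concavity keeps [psi] below the extended chord from [a] to [r1]. *)
Lemma phi_on_decay a psi r1 : phi_on a psi -> (a < r1)%R -> psi r1 < psi a ->
  exists b k, (0 < k)%R /\ forall r, (a <= r)%R -> psi r <= (b - k * r)%:E.
Proof.
move=> [f1 f2 f3 f4] ar1 h.
have [y0 y0E] : exists y0, psi a = y0%:E.
  move: h (f1 _ (lexx a)); case: (psi a) => [y0| |]; [by exists y0|by []|].
  by rewrite ltNge leNye.
rewrite y0E in h.
(* [psi r1] may be [-oo]; the real number [y] replaces it as the end of the chord. *)
have [y y1 y2] : exists2 y : R, psi r1 <= y%:E & (y < y0)%R.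
  move: h; case: (psi r1) => [s| |]//.
    by rewrite lte_fin; exists s.
  by exists (y0 - 1)%R; rewrite ?leNye// ltrBlDr ltrDl.
pose k := ((y0 - y) / (r1 - a))%R.
have k0 : (0 < k)%R by rewrite divr_gt0// subr_gt0.
(* The line has the slope of the chord and the value [y0] at [r1]: it lies above the constant [y0]
   before [r1] and above the chord everywhere. *)
exists (y0 + k * r1)%R, k; split => // r ar.
have [rr1|r1r] := leP r r1.
  rewrite (le_trans (f4 _ _ (lexx a) ar))// y0E lee_fin.
  by rewrite -addrA lerDl subr_ge0 ler_pM2l.
have ra : (0 < r - a)%R by rewrite subr_gt0 (lt_trans ar1).
pose t := ((r - r1) / (r - a))%R.
have t01 : (0 <= t <= 1)%R.
  rewrite /t divr_ge0 ?subr_ge0 ?(ltW r1r) ?(le_trans (ltW ar1) (ltW r1r))//=.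
  by rewrite ler_pdivrMr// mul1r lerB// ltW.
have t1E : (1 - t = (r1 - a) / (r - a))%R.
  by rewrite /t; field; rewrite gt_eqF.
have := f3 a r t (lexx a) ar t01.
rewrite (_ : t * a + (1 - t) * r = r1)%R; last first.
  by rewrite t1E /t; field; rewrite gt_eqF.
move=> /le_trans /(_ y1); rewrite y0E t1E.
have : psi r < +oo by exact: f1.
case: (psi r) => [s _|//|_]; last by rewrite leNye.
rewrite -!EFinM -EFinD !lee_fin => h1.
have r1a : (0 < r1 - a)%R by rewrite subr_gt0.
have {}h1 : ((r - r1) * y0 + (r1 - a) * s <= y * (r - a))%R.
  rewrite -ler_pdivrMr//; apply: le_trans h1; rewrite le_eqVlt; apply/orP; left.
  by apply/eqP; rewrite /t; field; rewrite gt_eqF.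
have h2 : ((r1 - a) * s <= (r1 - a) * (y0 - k * (r - a)))%R.
  rewrite mulrBr mulrA (mulrC _ k) /k divfK ?gt_eqF//; lra.
rewrite ler_pM2l// in h2; apply: (le_trans h2).
have h3 : (k * a <= k * r1)%R by rewrite ler_pM2l// ltW.
by move: h3; clearbody k; lra.
Qed.

Lemma radial_int_csty n a c : (0 <= a)%R ->
  radial_int n a (cst c%:E) = +oo.
Proof.
move=> a0; apply/eqP; rewrite -leye_eq.
(* On [[a + 1, +oo[] one has [r >= 1], hence [r ^+ n >= 1]. *)
have -> : +oo = \int[mu]_(r in `[(a + 1)%R, +oo[) (cst (expR c)%:E r).
  rewrite integral_cst//= lebesgue_measure_itv/= ltry addye//.
  by rewrite mulry gtr0_sg ?expR_gt0// mul1e.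
apply: (@le_trans _ _ (\int[mu]_(r in `[(a + 1)%R, +oo[) ((r ^+ n)%:E * (expR c)%:E))).
  apply: ge0_le_integral => //.
  - by move=> r _; rewrite lee_fin expR_ge0.
  - by apply: emeasurable_funM => //; apply/measurable_EFinP; exact: exprn_measurable.
  - move=> r /=; rewrite in_itv/= andbT => ar.
    rewrite -EFinM lee_fin ler_peMl ?expR_ge0// exprn_ege1// (le_trans _ ar)//.
    by rewrite lerDr.
apply: ge0_subset_integral => //.
- by apply: emeasurable_funM => //; apply/measurable_EFinP; exact: exprn_measurable.
- move=> r /=; rewrite in_itv/= andbT => ar.
  by rewrite mule_ge0// lee_fin ?expR_ge0// exprn_ge0// (le_trans a0).
- by move=> r /=; rewrite !in_itv/= !andbT; apply: le_trans; rewrite lerDl.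
Qed.

(** A nonincreasing function that never drops below its value at [a] is constant, and a finite
    constant has infinite radial integral. *)
Lemma phi_on_radial_decay n a psi : (0 <= a)%R -> phi_on a psi ->
  -oo < psi a -> radial_int n a psi < +oo ->
  exists b k, (0 < k)%R /\ forall r, (a <= r)%R -> psi r <= (b - k * r)%:E.
Proof.
move=> a0 hpsi psia J.
suff [r1 ar1 h] : exists2 r1, (a < r1)%R & psi r1 < psi a.
  exact: (phi_on_decay hpsi ar1).
apply: contrapT => H; move: J; rewrite ltNge => /negP; apply.
have [f1 _ _ f4] := hpsi.
have [c cE] : exists c, psi a = c%:E.
  by move: psia (f1 _ (lexx a)); case: (psi a) => [c _ _|//|//]; exists c.
rewrite -(@radial_int_csty n a c)// le_eqVlt; apply/orP; left; apply/eqP.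
apply: eq_integral => r rI; congr (_ * expeR _).
move: rI; rewrite inE /= in_itv/= andbT => ar.
rewrite -[LHS]cE; apply/eqP; rewrite eq_le; apply/andP; split; last exact: f4.
rewrite leNgt; apply/negP => rc; apply: H; exists r => //.
rewrite lt_neqAle ar andbT.
by apply/eqP => ra; move: rc; rewrite ra ltxx.
Qed.

End radial_integral.

(** * The first-order condition *)

Section pointwise.
Variable R : realType.
Implicit Types (w u v y z : R) (m : nat).

(** Bernoulli's inequality; the slack in the induction step is [m * (z - 1) ^ 2]. *)
Lemma bernoulli_ge0 z m : (0 <= z)%R -> (1 + m%:R * (z - 1) <= z ^+ m)%R.
Proof.
move=> z0; elim: m => [|m IH]; first by rewrite mul0r addr0 expr0.
rewrite exprS; apply: le_trans (ler_wpM2l z0 IH).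
rewrite -subr_ge0 -natr1.
rewrite (_ : _ - _ = m%:R * (z - 1) ^+ 2)%R; last by ring.
by rewrite mulr_ge0// sqr_ge0.
Qed.

(** Bernoulli at [z = expR (y / (m + 1))], whose power [m + 1] is [expR y]. This gives the
    dominating function, for either sign of [y]. *)
Lemma expR_secant_le y m : (m.+1%:R * (expR (y / m.+1%:R) - 1) <= expR y)%R.
Proof.
have := bernoulli_ge0 m.+1 (expR_ge0 (y / m.+1%:R)).
rewrite -expRM_natl (mulrC m.+1%:R (y / _)%R) divfK ?pnatr_eq0// => h.
by rewrite (le_trans _ h)// lerDr.
Qed.

(** With [s = y / (m + 1)], the bounds [1 + s <= e^s] and [1 - s <= e^(-s)] squeeze the quotient
    between [y] and [y e^s]. *)
Lemma cvg_expR_secant y :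
  (m.+1%:R * (expR (y / m.+1%:R) - 1))%R @[m --> \oo] --> y.
Proof.
have inv0 : (y / m.+1%:R)%R @[m --> \oo] --> (0%R : R).
  rewrite -[X in _ --> X](mulr0 y); apply: cvgMr; exact: cvg_harmonic.
have up : (y * expR (y / m.+1%:R))%R @[m --> \oo] --> y.
  rewrite -[X in _ --> X](mulr1 y); apply: cvgMr.
  rewrite -[X in _ --> X](expR0 R); apply: continuous_cvg => //.
  exact: continuous_expR.
apply: (@squeeze_cvgr _ _ _ _ (cst y) (fun m => y * expR (y / m.+1%:R))%R) => //.
- apply: nearW => m /=; set s := (y / m.+1%:R)%R.
  have yE : y = (m.+1%:R * s)%R by rewrite mulrC divfK ?pnatr_eq0.
  apply/andP; split.
    by rewrite {1}yE ler_pM2l ?ltr0n// lerBrDl expR_ge1Dx.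
  rewrite [X in (_ <= X * _)%R]yE -mulrA ler_pM2l ?ltr0n//.
  have h := expR_ge1Dx (- s); rewrite expRN in h.
  have e0 := expR_gt0 s.
  rewrite -(ler_pM2r e0) mulVf ?gt_eqF// in h; lra.
- exact: cvg_cst.
Qed.

End pointwise.

(** * Difference quotients at extended real values *)

Section secant_gap.
Variable R : realType.
Implicit Types (w s : R) (u v : \bar R) (m : nat).

(* With [w = c r^n], [u = phi* r], [v = x r], this is the slack between the
   dominating function [w e^(u+v)] and the difference quotient of
   [s |-> w e^(u + s v)] at [0] with step [1 / (m + 1)]. *)
Definition secant_gap w u v m : \bar R :=
  w%:E * expeR (u + v) -
  m.+1%:R%:E * (w%:E * expeR (u + (m.+1%:R^-1)%:E * v) - w%:E * expeR u).

Lemma expeRNy : expeR (-oo : \bar R) = 0.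
Proof. by []. Qed.

Lemma mul_expeR_fin w u : u < +oo -> w%:E * expeR u \is a fin_num.
Proof. by case: u => //= [r|] _; rewrite ?mule0. Qed.

Lemma secant_gap_ge0 w u v m : (0 <= w)%R -> u < +oo -> v < +oo ->
  0 <= secant_gap w u v m.
Proof.
move=> w0; rewrite /secant_gap; case: u => [u| |]// _; last first.
  by move=> _; rewrite !addNye !expeRNy !mule0 !(subee, mule0)//.
case: v => [v| |]// _.
  rewrite /= -EFinM -EFinD lee_fin subr_ge0.
  have h := expR_secant_le v m; rewrite -mulrBr mulrCA ler_wpM2l// !expRD (mulrC _ v).
  rewrite (_ : _ * _ - _ = expR u * (expR (v / m.+1%:R) - 1))%R; last by ring.
  by rewrite mulrCA ler_wpM2l ?expR_ge0.
(* At [v = -oo] the exponentials containing [v] vanish, and the gap is [(m + 1) w e^u]. *)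
rewrite gt0_muleNy ?lte_fin ?invr_gt0// !addeNy !expeRNy !mule0 !add0e.
rewrite /= lee_fin mulrN opprK.
by rewrite !mulr_ge0 ?expR_ge0.
Qed.

(** For finite [u] and [v] this is the derivative of the exponential. The gap vanishes identically
    when [w = 0] or [u = -oo]; when [v = -oo] alone it diverges to [+oo], which is also the value of
    the right-hand side. *)
Lemma secant_gap_cvg w u v : (0 <= w)%R -> u < +oo -> v < +oo ->
  secant_gap w u v @ \oo --> w%:E * expeR (u + v) - v * (w%:E * expeR u).
Proof.
rewrite le_eqVlt => /predU1P[<- _ _|w0 uy vy].
  rewrite (_ : secant_gap 0 u v = cst 0).
    by rewrite !mul0e mule0 subee//; exact: cvg_cst.
  by apply/funext => m; rewrite /secant_gap !mul0e !(subee, mule0).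
case: u uy => [u _|//|_]; last first.
  rewrite (_ : secant_gap w -oo v = cst 0).
    by rewrite !addNye !expeRNy !mule0 subee//; exact: cvg_cst.
  by apply/funext => m; rewrite /secant_gap !addNye !expeRNy !mule0 !(subee, mule0).
case: v vy => [v _|//|_].
  rewrite (_ : secant_gap w u%:E v%:E = EFin \o (fun m => w * expR (u + v) -
      (w * expR u) * (m.+1%:R * (expR (v / m.+1%:R) - 1)))%R); last first.
    apply/funext => m; rewrite /secant_gap /= -EFinM -EFinD.
    by congr (_ - _)%:E; rewrite (mulrC _ v) !expRD; ring.
  rewrite [X in _ --> X]/= -EFinM -EFinD (mulrC v); apply: cvg_EFin; first exact: nearW.
  by apply: cvgB; [exact: cvg_cst|apply: cvgMr; exact: cvg_expR_secant].
have wu : (0 < w * expR u)%R by rewrite mulr_gt0 ?expR_gt0.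
rewrite addeNy expeRNy mule0 add0e -EFinM mulNyr gtr0_sg// mul1e.
apply/cvgeyPge => A; near=> m.
rewrite /secant_gap gt0_muleNy ?lte_fin ?invr_gt0// !addeNy !expeRNy !mule0 !add0e.
rewrite /= lee_fin mulrN opprK -ler_pdivrMr//.
rewrite (@le_trans _ _ m%:R)// ?ler_nat//.
by near: m; exact: nbhs_infty_ger.
Unshelve. all: by end_near. Qed.

Lemma secant_gap_lim_ge0 w u v : (0 <= w)%R -> u < +oo -> v < +oo ->
  0 <= w%:E * expeR (u + v) - v * (w%:E * expeR u).
Proof.
move=> w0 uy vy; have h := secant_gap_cvg w0 uy vy.
rewrite -(cvg_lim _ h)//; apply: lime_ge; first by apply/cvg_ex; eexists; exact: h.
by apply: nearW => m; exact: secant_gap_ge0.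
Qed.

End secant_gap.

Lemma integralZl_gt0 d (T : measurableType d) (R : realType)
    (mu : {measure set T -> \bar R}) (D : set T) (mD : measurable D)
    (f : T -> \bar R) (k : R) : measurable_fun D f -> (0 < k)%R ->
  \int[mu]_(x in D) (k%:E * f x) = k%:E * \int[mu]_(x in D) f x.
Proof.
move=> mf k0; rewrite integralE (integralE _ _ f).
rewrite (ge0_funeposM _ (ltW k0)) (ge0_funenegM _ (ltW k0)).
rewrite !ge0_integralZl//; first last.
- by rewrite lee_fin ltW.
- exact: measurable_funepos.
- by rewrite lee_fin ltW.
- exact: measurable_funeneg.
have [Fp Fn] : 0 <= \int[mu]_(x in D) f^\+ x /\ 0 <= \int[mu]_(x in D) f^\- x.
  by split; exact: integral_ge0.
move: (integral _ _ _) (integral _ _ _) Fp Fn => [x| |] [y| |]// _ _.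
- by rewrite muleBr.
- by rewrite -EFinM addye// gt0_muley.
- by rewrite gt0_muley// !addeNy gt0_muleNy.
- by rewrite gt0_muley// !addeNy gt0_muleNy.
Qed.

(** * The first-order inequality in a measurable direction *)

Section variation.
Variable R : realType.
Variables (a c : R) (n : nat) (Q : probability (measurableTypeR R) R).
Hypotheses (a0 : (0 <= a)%R) (c0 : (0 < c)%R).
Hypotheses (Qa : Q `[a, +oo[%classic = 1)
  (Q1 : \int[Q]_(r in `[a, +oo[) r%:E < +oo).
Implicit Types (psi Delta : R -> \bar R).

Definition Lc psi : \bar R :=
  \int[Q]_(r in `[a, +oo[) psi r - c%:E * radial_int n a psi + 1.

(** By monotonicity [psi] is bounded above by [psi a], and [Q] is finite. *)
Lemma phi_on_integral_pos psi : phi_on a psi ->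
  \int[Q]_(r in `[a, +oo[) psi^\+ r < +oo.
Proof.
move=> hpsi; have [f1 _ _ f4] := hpsi.
have [M M0 aM] : exists2 M : R, (0 <= M)%R & psi a <= M%:E.
  move: (f1 _ (lexx a)); case: (psi a) => [x _|//|_]; last first.
    by exists 0%R; rewrite ?leNye.
  by exists `|x|%R; rewrite ?lee_fin ?ler_norm.
apply: (@le_lt_trans _ _ (\int[Q]_(r in `[a, +oo[) (cst M%:E) r)).
  apply: ge0_le_integral => //.
  - by apply: measurable_funepos; exact: measurable_phi_on.
  - move=> r; rewrite /= in_itv/= andbT => ar.
    by rewrite funeposE ge_max lee_fin M0 andbT (le_trans (f4 _ _ (lexx a) ar)).
rewrite integral_cst//= -ge0_fin_numE ?mule_ge0 ?lee_fin//.
by rewrite fin_numM//; apply: fin_num_measure; exact: measurable_itv.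
Qed.

Lemma phi_on_integral_lty psi : phi_on a psi ->
  \int[Q]_(r in `[a, +oo[) psi r < +oo.
Proof.
move=> /phi_on_integral_pos h; rewrite integralE.
by apply: le_lt_trans h; rewrite geeDl// leeNl oppe0 integral_ge0.
Qed.

Lemma radial_int_ge0 psi : 0 <= radial_int n a psi.
Proof.
apply: integral_ge0 => r /=; rewrite in_itv/= andbT => ar.
by rewrite mule_ge0 ?expeR_ge0// lee_fin exprn_ge0// (le_trans a0).
Qed.

(* Compare with the competitor [r |-> - r], at which the functional is finite. *)
Lemma maximiser_facts phi : phi_on a phi ->
  (forall psi, phi_on a psi -> Lc psi <= Lc phi) ->
  [/\ \int[Q]_(r in `[a, +oo[) phi r \is a fin_num,
      radial_int n a phi \is a fin_num & -oo < phi a].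
Proof.
move=> hphi hmax.
have h : -oo < Lc phi.
  have h1 := @phi_on_affine R a 0 1 ler01.
  apply: lt_le_trans (hmax _ h1).
  have J : radial_int n a (fun r => (0 - 1 * r)%:E) \is a fin_num.
    rewrite ge0_fin_numE ?radial_int_ge0//.
    by apply: (@radial_int_lty _ _ _ 0 1).
  have E : \int[Q]_(r in `[a, +oo[) (0 - 1 * r)%:E
           = - \int[Q]_(r in `[a, +oo[) r%:E.
    rewrite -integral_ge0N; last first.
      by move=> r /=; rewrite in_itv/= andbT lee_fin; exact: le_trans.
    by apply: eq_integral => r _; rewrite sub0r mul1r EFinN.
  rewrite /Lc E -(fineK J) -EFinM -EFinN -addeA -EFinD ltNye.
  by rewrite adde_eq_ninfty /= orbF eqe_oppLR lt_eqF.
have phiy := phi_on_integral_lty hphi.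
have phiN : \int[Q]_(r in `[a, +oo[) phi r != -oo.
  by apply/eqP => E; move: h; rewrite /Lc E addNye addNye ltxx.
have Jy : radial_int n a phi != +oo.
  apply/eqP => E; move: h; rewrite /Lc E gt0_muley ?lte_fin//.
  by rewrite addeNy addNye ltxx.
split.
- by rewrite fin_numE phiN lt_eqF.
- by rewrite ge0_fin_numE ?radial_int_ge0// ltey.
- rewrite ltNye; apply/eqP => E; move/eqP: phiN; apply.
  have [f1 _ _ f4] := hphi.
  transitivity (\int[Q]_(r in `[a, +oo[) (cst -oo) r).
    apply: eq_integral => r; rewrite inE /= in_itv/= andbT => ar.
    by apply/eqP; rewrite -leeNy_eq -E f4.
  rewrite integral_cst//= [X in -oo * X](_ : _ = 1)// mule1//.
Qed.

(** Step [s] is the convex combination of steps [0] and [t] with weight [s / t]; infinite values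
    need a separate check. *)
Lemma conv_translate (u v : \bar R) (t s : R) : u < +oo -> v < +oo ->
  (0 <= s < t)%R ->
  (1 - s / t)%:E * u + (s / t)%:E * (u + t%:E * v) = u + s%:E * v.
Proof.
move=> + + /andP[s0 st]; have t0 := le_lt_trans s0 st.
have t10 : (0 < 1 - s / t)%R by rewrite subr_gt0 ltr_pdivrMr ?mul1r.
case: u => [u| |]// _; last first.
  by rewrite gt0_muleNy ?lte_fin// !addNye.
case: v => [v| |]// _.
  by rewrite -!EFinM -!EFinD; congr EFin; field; rewrite gt_eqF.
rewrite [t%:E * _]gt0_muleNy ?lte_fin// addeNy.
move: s0; rewrite le_eqVlt => /predU1P[<-|s0].
  by rewrite mul0r !mul0e !adde0 subr0 mul1e.
by rewrite !gt0_muleNy ?lte_fin ?divr_gt0// !addeNy.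
Qed.

Lemma phi_on_translate phi Delta (t s : R) : phi_on a phi ->
  (forall r, (a <= r)%R -> Delta r < +oo) ->
  phi_on a (fun r => phi r + t%:E * Delta r) -> (0 <= s < t)%R ->
  phi_on a (fun r => phi r + s%:E * Delta r).
Proof.
move=> hphi Dy hpsi st; have /andP[s0 st1] := st; have [f1 _ _ _] := hphi.
have t0 := le_lt_trans s0 st1.
apply: (@eq_phi_on _ _ (fun r => (1 - s / t)%:E * phi r
    + (s / t)%:E * (phi r + t%:E * Delta r))).
  by move=> r ar; rewrite conv_translate ?f1 ?Dy.
apply: phi_onD; apply: phi_onZ => //.
  by rewrite subr_ge0 ler_pdivrMr ?mul1r// ltW.
by rewrite divr_ge0// ltW.
Qed.

(** Any positive weight on [phi] suffices: [phi] contributes the slope [(1 - s) * k], while [psi]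
    need only be bounded above. *)
Lemma radial_int_conv_lty phi psi (s : R) : phi_on a phi -> phi_on a psi ->
  -oo < phi a -> radial_int n a phi < +oo -> (0 <= s < 1)%R ->
  radial_int n a (fun r => (1 - s)%:E * phi r + s%:E * psi r) < +oo.
Proof.
move=> hphi hpsi phia J /andP[s0 s1]; have [f1 _ _ f4] := hpsi.
have [b [k [k0 H]]] := phi_on_radial_decay a0 hphi phia J.
have [M aM] : exists M : R, psi a <= M%:E.
  move: (f1 _ (lexx a)); case: (psi a) => [x _|//|_]; first by exists x.
  by exists 0%R; rewrite leNye.
have s10 : (0 < 1 - s)%R by rewrite subr_gt0.
apply: (@radial_int_lty _ n a ((1 - s) * b + s * M) ((1 - s) * k)) => //.
- by rewrite mulr_gt0.
- by apply: phi_onD; apply: phi_onZ => //; rewrite ltW.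
move=> r ar.
have -> : ((1 - s) * b + s * M - (1 - s) * k * r)%:E
          = (1 - s)%:E * (b - k * r)%:E + s%:E * M%:E.
  by rewrite -!EFinM -EFinD; congr EFin; ring.
apply: leeD; first by rewrite lee_pmul2l ?lte_fin// H.
by rewrite lee_wpmul2l ?lee_fin// (le_trans (f4 _ _ (lexx a) ar)).
Qed.

Lemma radial_int_translate_lty phi Delta (t s : R) : phi_on a phi ->
  (forall r, (a <= r)%R -> Delta r < +oo) ->
  phi_on a (fun r => phi r + t%:E * Delta r) -> (0 <= s < t)%R ->
  -oo < phi a -> radial_int n a phi < +oo ->
  radial_int n a (fun r => phi r + s%:E * Delta r) < +oo.
Proof.
move=> hphi Dy hpsi st phia J; have /andP[s0 st1] := st.
have t0 := le_lt_trans s0 st1; have [f1 _ _ _] := hphi.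
have s01 : (0 <= s / t < 1)%R.
  by rewrite divr_ge0 ?(ltW t0)//= ltr_pdivrMr ?mul1r.
rewrite (_ : radial_int n a _ = radial_int n a (fun r => (1 - s / t)%:E * phi r
    + (s / t)%:E * (phi r + t%:E * Delta r))); last first.
  apply: eq_integral => r; rewrite inE /= in_itv/= andbT => ar.
  by rewrite conv_translate ?f1 ?Dy.
exact: radial_int_conv_lty.
Qed.

(** Integrate [x^+ <= (phi + x)^+ + phi^-]: the first term is bounded, and the second is integrable
    because the maximiser has a finite [Q]-integral. *)
Lemma integral_pos_maximiser phi x : phi_on a phi ->
  (forall psi, phi_on a psi -> Lc psi <= Lc phi) ->
  measurable_fun `[a, +oo[%classic x -> phi_on a (fun r => phi r + x r) ->
  \int[Q]_(r in `[a, +oo[) x^\+ r < +oo.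
Proof.
move=> hphi hmax mx hpx.
have [phif _ _] := maximiser_facts hphi hmax.
have phin : \int[Q]_(r in `[a, +oo[) phi^\- r < +oo.
  apply: integral_pos_neNy; first exact: phi_on_integral_pos.
  by rewrite ltNye; move: phif; rewrite fin_numE => /andP[].
apply: (@le_lt_trans _ _
  (\int[Q]_(r in `[a, +oo[) ((phi \+ x)^\+ r + phi^\- r))).
  apply: ge0_le_integral => //.
  - exact: measurable_funepos.
  - apply: emeasurable_funD.
      by apply: measurable_funepos; exact: measurable_phi_on.
    by apply: measurable_funeneg; exact: measurable_phi_on.
  - move=> r; rewrite /= in_itv/= andbT => ar.
    rewrite !funeposE funenegE ge_max; apply/andP; split; last first.
      by rewrite adde_ge0// le_max lexx orbT.
    have [f1 _ _ _] := hphi; have := f1 _ ar.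
    case: (phi r) => [u| |]// _.
      apply: (@le_trans _ _ ((u%:E + x r) + - u%:E)).
        by rewrite addeAC -EFinN -EFinD subrr add0e.
      by apply: leeD; rewrite le_max lexx.
    by rewrite [maxe +oo 0]max_l// addey ?leey// gt_eqF// lt_max ltNy0 orbT.
rewrite ge0_integralD//; first last.
- by apply: measurable_funeneg; exact: measurable_phi_on.
- by apply: measurable_funepos; exact: (measurable_phi_on hpx).
by apply: lte_add_pinfty => //; exact: (phi_on_integral_pos hpx).
Qed.

Definition hdens psi r : \bar R := (c * r ^+ n)%:E * expeR (psi r).

Lemma hdensE psi r : hdens psi r = c%:E * ((r ^+ n)%:E * expeR (psi r)).
Proof. by rewrite /hdens EFinM muleA. Qed.

Lemma hdens_ge0 psi r : (a <= r)%R -> 0 <= hdens psi r.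
Proof.
move=> ar; rewrite mule_ge0 ?expeR_ge0// lee_fin mulr_ge0 ?(ltW c0)//.
by rewrite exprn_ge0// (le_trans a0).
Qed.

Lemma measurable_hdens psi : phi_on a psi ->
  measurable_fun `[a, +oo[%classic (hdens psi).
Proof.
move=> hpsi; rewrite (_ : hdens psi = fun r => c%:E * ((r ^+ n)%:E * expeR (psi r))).
  by apply: measurable_funeM; exact: measurable_radial.
by apply/funext => r; rewrite hdensE.
Qed.

Lemma integral_hdens psi : phi_on a psi ->
  \int[lebesgue_measure]_(r in `[a, +oo[) hdens psi r = c%:E * radial_int n a psi.
Proof.
move=> hpsi; under eq_integral do rewrite hdensE.
rewrite ge0_integralZl//.
- exact: measurable_radial.
- move=> r /=; rewrite in_itv/= andbT => ar.
  by rewrite mule_ge0 ?expeR_ge0// lee_fin exprn_ge0// (le_trans a0).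
- by rewrite lee_fin ltW.
Qed.

Lemma integrable_hdens psi : phi_on a psi -> radial_int n a psi < +oo ->
  (@lebesgue_measure R).-integrable `[a, +oo[%classic (hdens psi).
Proof.
move=> hpsi J; apply/integrableP; split; first exact: measurable_hdens.
under eq_integral => r.
  by rewrite inE /= in_itv/= andbT => ar; rewrite gee0_abs ?hdens_ge0//; over.
rewrite integral_hdens// -ge0_fin_numE ?mule_ge0 ?radial_int_ge0 ?lee_fin ?(ltW c0)//.
by rewrite fin_numM// ge0_fin_numE// radial_int_ge0.
Qed.

(* The factor 2 leaves room to compare: [phi + x] is the midpoint of [phi] and
   [phi + 2 x], so it inherits the exponential decay of [phi]. *)
Lemma variation_measurable phi x : phi_on a phi ->
  (forall psi, phi_on a psi -> Lc psi <= Lc phi) ->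
  (forall r, (a <= r)%R -> x r < +oo) ->
  measurable_fun `[a, +oo[%classic x ->
  phi_on a (fun r => phi r + 2%R%:E * x r) ->
  \int[Q]_(r in `[a, +oo[) x r
    <= \int[lebesgue_measure]_(r in `[a, +oo[) (x r * hdens phi r).
Proof.
move=> hphi hmax xy mx h2.
have [Pf Jf phia] := maximiser_facts hphi hmax.
have [f1 _ _ _] := hphi.
(* All steps [1 / (m + 1)] are below the admissible step [2]; [chi 0] gives the dominating
   function. *)
pose chi m r := phi r + (m.+1%:R^-1)%:E * x r.
have s02 m : (0 <= (m.+1%:R^-1 : R) < 2)%R.
  rewrite invr_ge0 ler0n/= (@le_lt_trans _ _ 1%R) ?ltr1n//.
  by rewrite invf_le1 ?ler1n ?ltr0n.
have hchi m : phi_on a (chi m) by exact: (phi_on_translate hphi xy h2 (s02 m)).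
have Jphi : radial_int n a phi < +oo.
  by rewrite -ge0_fin_numE// radial_int_ge0.
have Jchi m : radial_int n a (chi m) < +oo.
  exact: (radial_int_translate_lty hphi xy h2 (s02 m)).
have chi0 : chi 0%N = (fun r => phi r + x r).
  by apply/funext => r; rewrite /chi invr1 mul1e.
have xp : \int[Q]_(r in `[a, +oo[) x^\+ r < +oo.
  by apply: (integral_pos_maximiser hphi hmax mx); rewrite -chi0.
pose I psi := \int[lebesgue_measure]_(r in `[a, +oo[) hdens psi r.
have If psi : phi_on a psi -> radial_int n a psi < +oo -> I psi \is a fin_num.
  move=> hpsi J; rewrite /I integral_hdens// fin_numM// ge0_fin_numE//.
  exact: radial_int_ge0.
(* Maximality against [chi m]: the finite [Q]-integral of [phi] cancels, and multiplying by [m + 1]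
   leaves the difference quotient. *)
have secant m : \int[Q]_(r in `[a, +oo[) x r
    <= m.+1%:R%:E * (I (chi m) - I phi).
  have := hmax _ (hchi m); rewrite /Lc -!integral_hdens//.
  have mxm : measurable_fun `[a, +oo[%classic (fun r => (m.+1%:R^-1)%:E * x r).
    exact: measurable_funeM.
  have xmp : \int[Q]_(r in `[a, +oo[) (fun r => (m.+1%:R^-1)%:E * x r)^\+ r < +oo.
    exact: (integral_pos_maximiser hphi hmax mxm (hchi m)).
  have phip := phi_on_integral_pos hphi.
  have -> : \int[Q]_(r in `[a, +oo[) chi m r = \int[Q]_(r in `[a, +oo[) phi r
      + \int[Q]_(r in `[a, +oo[) ((m.+1%:R^-1)%:E * x r).
    apply: integralD_pos => //; exact: measurable_phi_on.
  rewrite integralZl_gt0// -/(I phi) -/(I (chi m)).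
  have k0 : (0 < m.+1%:R :> R)%R by [].
  move: (If _ (hchi m) (Jchi m)) (If _ hphi Jphi) Pf.
  move: (I (chi m)) (I phi) => [u| |]// [v| |]// _ _.
  move: (\int[Q]_(r in `[a, +oo[) phi r) => [w| |]// _.
  move: (\int[Q]_(r in `[a, +oo[) x r) => [X| |].
  - rewrite -EFinM -!EFinD -EFinM !lee_fin -ler_pdivrMl//.
    by move: (_ * X)%R => z; lra.
  - by rewrite gt0_muley ?lte_fin ?invr_gt0.
  - by rewrite leNye.
pose G m r := secant_gap (c * r ^+ n) (phi r) (x r) m.
have GE m r : G m r = hdens (chi 0%N) r - m.+1%:R%:E * (hdens (chi m) r - hdens phi r).
  by rewrite chi0.
have w0 r : (a <= r)%R -> (0 <= c * r ^+ n)%R.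
  by move=> ar; rewrite mulr_ge0 ?(ltW c0)// exprn_ge0// (le_trans a0).
have mG m : measurable_fun `[a, +oo[%classic (G m).
  rewrite (_ : G m = fun r => hdens (chi 0%N) r -
      m.+1%:R%:E * (hdens (chi m) r - hdens phi r)); last first.
    by apply/funext => r; rewrite GE.
  apply: emeasurable_funB; first exact: measurable_hdens.
  by apply: measurable_funeM; apply: emeasurable_funB; exact: measurable_hdens.
have G0 m r : `[a, +oo[%classic r -> 0 <= G m r.
  by rewrite /= in_itv/= andbT => ar; apply: secant_gap_ge0; rewrite ?w0 ?f1 ?xy.
have intG m : \int[lebesgue_measure]_(r in `[a, +oo[) G m r =
    I (chi 0%N) - m.+1%:R%:E * (I (chi m) - I phi).
  under eq_integral do rewrite GE.
  have iD : (@lebesgue_measure R).-integrable `[a, +oo[%classic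
      (fun r => hdens (chi m) r - hdens phi r).
    by apply: integrableB => //; exact: integrable_hdens.
  rewrite integralB//; last 2 first.
  - exact: integrable_hdens.
  - exact: integrableZl.
  by rewrite integralZl// integralB//; exact: integrable_hdens.
have mL : measurable_fun `[a, +oo[%classic (fun r => x r * hdens phi r).
  by apply: emeasurable_funM => //; exact: measurable_hdens.
(* The pointwise limit of [G], possibly [+oo], to which Fatou's lemma applies. *)
pose D r := hdens (chi 0%N) r - x r * hdens phi r.
have D0 r : (a <= r)%R -> 0 <= D r.
  by move=> ar; rewrite /D chi0; apply: secant_gap_lim_ge0; rewrite ?w0 ?f1 ?xy.
have mD : measurable_fun `[a, +oo[%classic D.
  by apply: emeasurable_funB => //; exact: measurable_hdens.
have DI : \int[lebesgue_measure]_(r in `[a, +oo[) D r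
    <= I (chi 0%N) - \int[Q]_(r in `[a, +oo[) x r.
  have -> : \int[lebesgue_measure]_(r in `[a, +oo[) D r =
      \int[lebesgue_measure]_(r in `[a, +oo[) limn_einf (G ^~ r).
    apply: eq_integral => r; rewrite inE /= in_itv/= andbT => ar.
    have := secant_gap_cvg (w0 _ ar) (f1 _ ar) (xy _ ar).
    by move=> /cvg_limn_einf_sup[-> _]; rewrite /D chi0.
  apply: (le_trans (@fatou _ _ R lebesgue_measure _ (measurable_itv _) G mG G0)).
  rewrite limn_einf_lim; apply: lime_le; first exact: is_cvg_einfs.
  apply: nearW => m.
  apply: (@le_trans _ _ (\int[lebesgue_measure]_(r in `[a, +oo[) G m r)).
    by apply: ereal_inf_lbound; exists m => /=.
  by rewrite intG leeB.
(* Subtraction recovers [x * hdens phi] even where [D = +oo], because [hdens (chi 0)] is finite. *)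
have xE r : (a <= r)%R -> x r * hdens phi r = hdens (chi 0%N) r + - D r.
  move=> ar; rewrite /D; have [g1 _ _ _] := hchi 0%N.
  have fA : hdens (chi 0%N) r \is a fin_num by apply: mul_expeR_fin; exact: g1.
  move: (hdens (chi 0%N) r) (x r * hdens phi r) fA => [u| |]// [v| |]// _.
  by rewrite -!EFinB; congr EFin; ring.
have -> : \int[lebesgue_measure]_(r in `[a, +oo[) (x r * hdens phi r)
    = I (chi 0%N) - \int[lebesgue_measure]_(r in `[a, +oo[) D r.
  transitivity (\int[lebesgue_measure]_(r in `[a, +oo[) (hdens (chi 0%N) r + - D r)).
    by apply: eq_integral => r; rewrite inE /= in_itv/= andbT => /xE.
  rewrite integralD_pos//; first last.
  - rewrite (eq_integral (cst 0)); first by rewrite integral0.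
    move=> r; rewrite inE /= in_itv/= andbT => /D0 Dr.
    by rewrite funeposE max_r// leeNl oppe0.
  - apply: (@le_lt_trans _ _ (I (chi 0%N))); last first.
      by rewrite ltey; move: (If _ (hchi 0%N) (Jchi 0%N)); rewrite fin_numE => /andP[].
    rewrite le_eqVlt; apply/orP; left; apply/eqP.
    apply: eq_integral => r; rewrite inE /= in_itv/= andbT => ar.
    by rewrite funeposE max_l// hdens_ge0.
  - exact: measurableT_comp mD.
  - exact: measurable_hdens.
  rewrite integral_ge0N// => r /=; rewrite in_itv/= andbT; exact: D0.
have DI0 : 0 <= \int[lebesgue_measure]_(r in `[a, +oo[) D r.
  by apply: integral_ge0 => r /=; rewrite in_itv/= andbT; exact: D0.
(* If the integral of [D] is infinite, [DI] forces the [Q]-integral of [x] to be [-oo]. *)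
move: DI DI0 (If _ (hchi 0%N) (Jchi 0%N)).
move: (\int[lebesgue_measure]_(r in `[a, +oo[) D r) => U.
move: (\int[Q]_(r in `[a, +oo[) x r) (I _) U => [v| |] [w| |] [u| |]//=.
- by rewrite -!EFinB !lee_fin => h _ _; lra.
- by move=> _ _ _; rewrite leNye.
Qed.

End variation.

(** * Arbitrary directions, the mean and the entropy *)

Section variation_general.
Variable R : realType.
Variables (a c : R) (n : nat) (Q : probability (measurableTypeR R) R).
Hypotheses (a0 : (0 <= a)%R) (c0 : (0 < c)%R).
Hypotheses (Qa : Q `[a, +oo[%classic = 1)
  (Q1 : \int[Q]_(r in `[a, +oo[) r%:E < +oo).
Variable phi : R -> \bar R.
Hypotheses (hphi : phi_on a phi)
  (hmax : forall psi, phi_on a psi -> Lc a c n Q psi <= Lc a c n Q phi).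
Implicit Types (Delta : R -> \bar R) (t : R).

(* [Delta] is arbitrary, possibly non-measurable, where [phi = -oo]; that set is
   [Q]-null and carries no mass of the density. *)
Definition truncate_dom Delta (r : R) : \bar R :=
  if phi r == -oo then 0 else Delta r.

Lemma measurable_set_phiNy : measurable (`[a, +oo[%classic `&` [set r | phi r = -oo]).
Proof.
exact: (measurable_phi_on hphi (measurable_itv _) (emeasurable_set1 -oo)).
Qed.

(** The maximiser is [Q]-integrable, hence finite almost everywhere. *)
Lemma probability_phiNy_eq0 : Q (`[a, +oo[%classic `&` [set r | phi r = -oo]) = 0.
Proof.
have [phif _ _] := maximiser_facts a0 c0 Qa Q1 hphi hmax.
have phip := phi_on_integral_pos Q hphi.
have phin : \int[Q]_(r in `[a, +oo[) phi^\- r < +oo.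
  apply: integral_pos_neNy => //.
  by rewrite ltNye; move: phif; rewrite fin_numE => /andP[].
have /integrable_ae : Q.-integrable `[a, +oo[%classic phi.
  by apply: integrable_posneg => //; exact: measurable_phi_on.
move=> /(_ (measurable_itv _)) aeQ.
apply/negligibleP; first exact: measurable_set_phiNy.
apply: negligibleS aeQ => r [ar rE] /= /(_ ar).
by rewrite rE.
Qed.

Lemma integral_setD_phiNy (f : R -> \bar R) :
  \int[Q]_(r in `[a, +oo[) f r =
  \int[Q]_(r in `[a, +oo[ `\` (`[a, +oo[ `&` [set r | phi r = -oo])) f r.
Proof.
apply: (@integral_null_setD _ (measurableTypeR R) R Q) => //.
  exact: measurable_set_phiNy.
exact: probability_phiNy_eq0.
Qed.

(** Where [phi] is finite, [Delta] is [1 / t] times the difference of two admissible, hence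
    measurable, functions. *)
Lemma measurable_truncate_dom Delta t : (0 < t)%R ->
  (forall r, (a <= r)%R -> Delta r < +oo) ->
  phi_on a (fun r => phi r + t%:E * Delta r) ->
  measurable_fun `[a, +oo[%classic (truncate_dom Delta).
Proof.
move=> t0 Dy hpsi; have [f1 _ _ _] := hphi.
apply: measurable_fun_if => //.
  apply: measurable_fun_eqe => //; exact: measurable_phi_on.
set E := (X in measurable_fun X _).
have ED : E `<=` `[a, +oo[%classic by move=> r [].
apply: (@eq_measurable_fun _ _ _ _ E
    (fun r => (t^-1)%:E * ((phi r + t%:E * Delta r) - phi r))).
  move=> r; rewrite inE => -[/=]; rewrite in_itv/= andbT => ar.
  move: (f1 _ ar) (Dy _ ar); case: (phi r) => [u| |]// _.
  case: (Delta r) => [v| |]// _ _.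
    by rewrite -EFinM; congr EFin; field; rewrite gt_eqF.
  by rewrite gt0_muleNy ?lte_fin// addeNy addNye gt0_muleNy// lte_fin invr_gt0.
apply: (measurable_funS (measurable_itv _) ED).
apply: measurable_funeM; apply: emeasurable_funB; exact: measurable_phi_on.
Qed.

Lemma integral_truncate_dom Delta :
  \int[Q]_(r in `[a, +oo[) truncate_dom Delta r = \int[Q]_(r in `[a, +oo[) Delta r.
Proof.
rewrite integral_setD_phiNy.
rewrite [RHS]integral_setD_phiNy.
apply: eq_integral => r; rewrite inE => -[/= ar H]; rewrite /truncate_dom.
by case: eqP => // E; exfalso; apply: H.
Qed.

Lemma translate_truncate_dom Delta t r : (0 < t)%R -> Delta r < +oo ->
  phi r + t%:E * truncate_dom Delta r = phi r + t%:E * Delta r.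
Proof.
by move=> t0 Dy; rewrite /truncate_dom; case: eqP => // ->; rewrite !addNye.
Qed.

Lemma truncate_dom_hdens Delta r :
  truncate_dom Delta r * hdens c n phi r = Delta r * hdens c n phi r.
Proof.
by rewrite /truncate_dom; case: eqP => // E; rewrite /hdens E expeRNy !mule0.
Qed.

Lemma truncate_dom_lty Delta : (forall r, (a <= r)%R -> Delta r < +oo) ->
  forall r, (a <= r)%R -> truncate_dom Delta r < +oo.
Proof. by move=> Dy r ar; rewrite /truncate_dom; case: ifP => // _; exact: Dy. Qed.

Lemma integral_pos_truncate_dom Delta t : (0 < t)%R ->
  (forall r, (a <= r)%R -> Delta r < +oo) ->
  phi_on a (fun r => phi r + t%:E * Delta r) ->
  \int[Q]_(r in `[a, +oo[) (truncate_dom Delta)^\+ r < +oo.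
Proof.
move=> t0 Dy hpsi; have mT := measurable_truncate_dom t0 Dy hpsi.
have : \int[Q]_(r in `[a, +oo[) (fun r => t%:E * truncate_dom Delta r)^\+ r < +oo.
  apply: (integral_pos_maximiser a0 c0 Qa Q1 hphi hmax); first exact: measurable_funeM.
  apply: eq_phi_on hpsi => r ar.
  by rewrite translate_truncate_dom// Dy.
rewrite (ge0_funeposM _ (ltW t0)) ge0_integralZl//; last 2 first.
- exact: measurable_funepos.
- by rewrite lee_fin ltW.
case: (integral _ _ _) => [x _||//]; first exact: ltry.
by rewrite gt0_muley ?lte_fin.
Qed.

Lemma variation Delta t : (0 < t)%R ->
  (forall r, (a <= r)%R -> Delta r < +oo) ->
  phi_on a (fun r => phi r + t%:E * Delta r) ->
  \int[Q]_(r in `[a, +oo[) Delta r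
    <= \int[lebesgue_measure]_(r in `[a, +oo[) (Delta r * hdens c n phi r).
Proof.
move=> t0 Dy hpsi; rewrite -integral_truncate_dom.
under [leRHS]eq_integral do rewrite -truncate_dom_hdens.
have mT := measurable_truncate_dom t0 Dy hpsi.
have Ty := truncate_dom_lty Dy.
have t20 : (0 < t / 2)%R by rewrite divr_gt0.
(* Rescaling the direction by [t / 2] turns the admissible step [t] into [2]; the factor is
   cancelled at the end. *)
have h : \int[Q]_(r in `[a, +oo[) ((t / 2)%:E * truncate_dom Delta r)
  <= \int[lebesgue_measure]_(r in `[a, +oo[)
       (((t / 2)%:E * truncate_dom Delta r) * hdens c n phi r).
  apply: (variation_measurable a0 c0 Qa Q1 hphi hmax).
  - move=> r /Ty; case: (truncate_dom _ _) => [v| |]// _; rewrite ?ltry//.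
    by rewrite gt0_muleNy ?lte_fin.
  - exact: measurable_funeM.
  - apply: eq_phi_on hpsi => r ar; rewrite muleA -EFinM.
    rewrite (_ : 2 * (t / 2) = t)%R; last by field.
    by rewrite translate_truncate_dom// Dy.
have mTh : measurable_fun `[a, +oo[%classic
    (fun r => truncate_dom Delta r * hdens c n phi r).
  by apply: emeasurable_funM => //; exact: measurable_hdens.
move: h; rewrite integralZl_gt0//.
under [leRHS]eq_integral do rewrite -muleA.
by rewrite integralZl_gt0// lee_pmul2l// lte_fin.
Qed.

Lemma variation_mean :
  \int[lebesgue_measure]_(r in `[a, +oo[) (r%:E * hdens c n phi r)
    <= \int[Q]_(r in `[a, +oo[) r%:E.
Proof.
have hpsi : phi_on a (fun r => phi r + 1%:E * (- r%:E)).
  apply: eq_phi_on (phi_onD hphi (phi_on_affine a 0 (ler01 : (0 <= 1 :> R)%R))).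
  by move=> r _; rewrite mul1e sub0r mul1r.
have h : \int[Q]_(r in `[a, +oo[) - r%:E
    <= \int[lebesgue_measure]_(r in `[a, +oo[) (- r%:E * hdens c n phi r).
  by apply: (variation ltr01 _ hpsi) => r _; rewrite -EFinN ltry.
rewrite -leeN2 -!integral_ge0N.
- apply: (le_trans h); rewrite le_eqVlt; apply/orP; left; apply/eqP.
  by apply: eq_integral => r _; rewrite -mulNe.
- move=> r /=; rewrite in_itv/= andbT => ar.
  by apply: mule_ge0; [rewrite lee_fin (le_trans a0)|exact: (hdens_ge0 _ a0 c0 _ ar)].
- by move=> r /=; rewrite in_itv/= andbT lee_fin; exact: le_trans.
Qed.

(* The perturbation is [Delta = phi0 - phi] cut off at the domain of [phi].  Only
   a step smaller than 1 is admissible: [phi + Delta] is [phi0] cut off at the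
   domain of [phi], which need not be upper semi-continuous. *)
Lemma variation_entropy phi0 : phi_on a phi0 ->
  \int[lebesgue_measure]_(r in `[a, +oo[) (hdens c n phi r * (phi r - phi0 r))
    <= \int[Q]_(r in `[a, +oo[) (phi r - phi0 r).
Proof.
move=> hphi0; have [f1 _ _ _] := hphi; have [g1 _ _ _] := hphi0.
pose Delta := truncate_dom (fun r => phi0 r - phi r).
have DeltaE r : phi r != -oo -> Delta r = phi0 r - phi r.
  by rewrite /Delta /truncate_dom => /negbTE ->.
have Dy r : (a <= r)%R -> Delta r < +oo.
  move=> ar; rewrite /Delta /truncate_dom; case: eqP => // phiN.
  move: (f1 _ ar) (g1 _ ar) phiN; case: (phi r) => [u| |]// _.
  by case: (phi0 r) => [v| |]// _ _; rewrite ltry.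
have t0 : (0 < 2^-1 :> R)%R by rewrite invr_gt0.
(* At step one half the perturbed function is the average of [phi] and [phi0], also at infinite
   values. *)
have hpsi : phi_on a (fun r => phi r + (2^-1)%:E * Delta r).
  apply: eq_phi_on (phi_onD (phi_onZ (ltW t0) hphi) (phi_onZ (ltW t0) hphi0)).
  move=> r ar; have [E|N] := eqVneq (phi r) -oo.
    by rewrite E gt0_muleNy ?lte_fin// !addNye.
  rewrite DeltaE//.
  move: (f1 _ ar) (g1 _ ar) N; case: (phi r) => [u| |]// _.
  case: (phi0 r) => [v| |]// _ _.
    by rewrite -!EFinM -!EFinD; congr EFin; field.
  by rewrite addNye gt0_muleNy ?lte_fin// !addeNy.
have TD : truncate_dom Delta = Delta.
  by apply/funext => r; rewrite /Delta /truncate_dom; case: (phi r == -oo).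
have mD : measurable_fun `[a, +oo[%classic Delta.
  by have := measurable_truncate_dom t0 Dy hpsi; rewrite TD.
have Dp : \int[Q]_(r in `[a, +oo[) Delta^\+ r < +oo.
  by have := integral_pos_truncate_dom t0 Dy hpsi; rewrite TD.
pose f r := Delta r * hdens c n phi r.
have -> : \int[lebesgue_measure]_(r in `[a, +oo[) (hdens c n phi r * (phi r - phi0 r))
    = \int[lebesgue_measure]_(r in `[a, +oo[) - f r.
  apply: eq_integral => r; rewrite inE /= in_itv/= andbT => ar.
  rewrite /f; have [E|N] := eqVneq (phi r) -oo.
    by rewrite /hdens E expeRNy !mule0 mul0e oppe0.
  rewrite DeltaE// -mulNe muleC; congr (_ * _).
  move: (f1 _ ar) (g1 _ ar) N; case: (phi r) => [u| |]// _.
  by case: (phi0 r) => [v| |]// _ _; rewrite -!EFinB -EFinN opprB.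
have -> : \int[Q]_(r in `[a, +oo[) (phi r - phi0 r)
    = \int[Q]_(r in `[a, +oo[) - Delta r.
  rewrite integral_setD_phiNy.
  rewrite [RHS]integral_setD_phiNy.
  apply: eq_integral => r; rewrite inE => -[/=]; rewrite in_itv/= andbT => ar H.
  have N : phi r != -oo by apply/eqP => E; apply: H.
  rewrite DeltaE//.
  move: (f1 _ ar) (g1 _ ar) N; case: (phi r) => [u| |]// _.
  by case: (phi0 r) => [v| |]// _ _; rewrite -!EFinB -EFinN opprB.
have addeN (u v : \bar R) : u < +oo -> 0 <= v -> u +? - v.
  move=> uy v0; rewrite ltpinfty_adde_def// inE lteNl.
  by rewrite (lt_le_trans (ltNyr 0)).
rewrite [leRHS]integralN; last by apply: addeN => //; exact: integral_ge0.
have := variation t0 Dy hpsi; rewrite -/(f _).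
(* Negation commutes with the integral unless both parts are infinite. If [f^+] has infinite
   integral, the integral of [- f] is [-oo] by convention and the claim is trivial. *)
have [fp|] := ltP (\int[lebesgue_measure]_(r in `[a, +oo[) f^\+ r) +oo.
  by move=> h; rewrite integralN ?leeN2//; apply: addeN => //; exact: integral_ge0.
rewrite leye_eq => /eqP fp _.
have -> : \int[lebesgue_measure]_(r in `[a, +oo[) - f r = -oo.
  rewrite integralE [X in _ - X](_ : _ = +oo) ?addeNy//.
  apply: etrans fp; apply: eq_integral => r _.
  by rewrite funenegE funeposE oppeK.
exact: leNye.
Qed.

End variation_general.

(** * Scale equivariance *)

Lemma integral_dilation (R : realType) (k a : R)
    (P Q : probability (measurableTypeR R) R) (f : R -> \bar R) : (0 < k)%R ->
  (forall A, measurable A -> P A = pushforward Q (dilation k) A) ->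
  measurable_fun `[(k * a)%R, +oo[%classic f ->
  \int[P]_(r in `[(k * a)%R, +oo[) f r = \int[Q]_(r in `[a, +oo[) f (k * r)%R.
Proof.
move=> k0 PQ mf.
have kaE : (k * a / k = a)%R by rewrite mulrAC divff ?gt_eqF// mul1r.
have ge0 (g : R -> \bar R) : measurable_fun `[(k * a)%R, +oo[%classic g ->
    (forall r, 0 <= g r) ->
    \int[P]_(r in `[(k * a)%R, +oo[) g r = \int[Q]_(r in `[a, +oo[) g (k * r)%R.
  move=> mg g0.
  transitivity (\int[pushforward Q (dilation k)]_(r in `[(k * a)%R, +oo[) g r).
    by apply: eq_measure_integral => A mA _; exact: PQ.
  rewrite ge0_integral_pushforward//.
  by rewrite dilation_preimage_itvcy// kaE.
rewrite integralE [RHS]integralE; congr (_ - _).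
  rewrite ge0//; last exact: measurable_funepos.
  by apply: eq_integral => r _; rewrite !funeposE.
rewrite ge0//; last exact: measurable_funeneg.
by apply: eq_integral => r _; rewrite !funenegE.
Qed.

Section dilation_L.
Variable R : realType.
Variables (k a c : R) (n : nat) (P Q : probability (measurableTypeR R) R).
Hypotheses (a0 : (0 <= a)%R) (k0 : (0 < k)%R).
Hypothesis (PQ : forall A, measurable A -> P A = pushforward Q (dilation k) A).
Hypothesis (Qa : Q `[a, +oo[%classic = 1).
Implicit Types psi : R -> \bar R.

(** The added constant is the logarithm of [k ^+ n.+1]: one factor [k] is the Jacobian, the others
    come from [(k * r) ^+ n]. *)
Definition rescale psi (r : R) : \bar R := psi (k * r)%R + (n.+1%:R * ln k)%:E.

Lemma phi_on_cst (b d : R) : phi_on b (cst d%:E).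
Proof.
apply: eq_phi_on (phi_on_affine b d (lexx (0%R : R))) => r _.
by rewrite mul0r subr0.
Qed.

Lemma phi_on_rescale psi : phi_on (k * a) psi -> phi_on a (rescale psi).
Proof.
move=> /(phi_on_scale k0).
rewrite (_ : k * a / k = a)%R; last by rewrite mulrAC divff ?gt_eqF// mul1r.
by move=> /phi_onD; apply; exact: phi_on_cst.
Qed.

Lemma expR_lnX : expR (n.+1%:R * ln k) = (k ^+ n.+1)%R.
Proof. by rewrite expRM_natl lnK// posrE. Qed.

Lemma radial_int_rescale psi : phi_on (k * a) psi ->
  radial_int n (k * a) psi = radial_int n a (rescale psi).
Proof.
move=> hpsi; rewrite /radial_int (ge0_integral_lebesgue_dilation k0)//; last 2 first.
- exact: measurable_radial.
- move=> r ar; rewrite mule_ge0 ?expeR_ge0// lee_fin exprn_ge0//.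
  by rewrite (le_trans _ ar)// mulr_ge0// ltW.
rewrite (_ : k * a / k = a)%R; last by rewrite mulrAC divff ?gt_eqF// mul1r.
rewrite -ge0_integralZl//.
- apply: eq_integral => r _; rewrite /rescale expeRD.
  rewrite -[expeR (_ * _)%:E]/((expR (n.+1%:R * ln k))%:E) expR_lnX.
  rewrite [in RHS](muleC (expeR _)) !muleA -!EFinM; congr (_%:E * _).
  by rewrite exprMn exprS; ring.
- have [_ _ _ f4] := phi_on_rescale hpsi.
  apply: emeasurable_funM.
    apply/measurable_EFinP; apply: measurable_funX; exact: mulrl_measurable.
  have [_ _ _ g4] := phi_on_scale k0 hpsi.
  rewrite (_ : k * a / k = a)%R in g4; last by rewrite mulrAC divff ?gt_eqF// mul1r.
  by apply: emeasurable_nonincreasing => x y ax xy; rewrite lee_expeR g4.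
- move=> r /=; rewrite in_itv/= andbT => ar.
  rewrite mule_ge0 ?expeR_ge0// lee_fin exprn_ge0// mulr_ge0 ?(ltW k0)//.
  exact: le_trans ar.
- by rewrite lee_fin ltW.
Qed.

(** The radial term is invariant, and the linear term shifts by a constant because [Q] has mass one
    on [[a, +oo[]. *)
Lemma Lc_rescale psi : phi_on (k * a) psi ->
  Lc (k * a) c n P psi = Lc a c n Q (rescale psi) - (n.+1%:R * ln k)%:E.
Proof.
move=> hpsi; rewrite /Lc radial_int_rescale//.
rewrite (integral_dilation k0 PQ (measurable_phi_on hpsi)).
have -> : \int[Q]_(r in `[a, +oo[) rescale psi r =
    \int[Q]_(r in `[a, +oo[) psi (k * r)%R + (n.+1%:R * ln k)%:E.
  have hpsik : phi_on a (fun r => psi (k * r)%R).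
    have := phi_on_scale k0 hpsi.
    by rewrite (_ : k * a / k = a)%R// mulrAC divff ?gt_eqF// mul1r.
  have hc := phi_on_cst a (n.+1%:R * ln k).
  transitivity (\int[Q]_(r in `[a, +oo[) psi (k * r)%R
      + \int[Q]_(r in `[a, +oo[) cst (n.+1%:R * ln k)%:E r).
    apply: (@integralD_pos _ (measurableTypeR R) R Q) => //.
    - exact: measurable_phi_on.
    - exact: phi_on_integral_pos.
    - exact: (phi_on_integral_pos Q hc).
  congr (_ + _); rewrite integral_cst//.
  by rewrite -[RHS]mule1; congr (_ * _); exact: Qa.
move: (\int[Q]_(r in `[a, +oo[) psi (k * r)%R) (c%:E * _) => x y.
set l := (_ * ln k)%R; case: x => [x| |]; case: y => [y| |] //.
by congr EFin; ring.
Qed.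

End dilation_L.

(** * The constant *)

Lemma lebesgue_rV_ge0 (R : realType) (p : nat) (K : set 'rV[R]_p) :
  0 <= lebesgue_rV K.
Proof.
apply: le_ereal_inf_tmp => _ [lu _ <-]; apply: nneseries_ge0 => k _ _.
by rewrite lee_fin prodr_ge0// => i _; rewrite le_max lexx orbT.
Qed.

Lemma lebesgue_rV_lty (R : realType) (p : nat) (K : set 'rV[R]_p) :
  (0 < p)%N -> compact K -> lebesgue_rV K < +oo.
Proof.
move=> p0 /compact_bounded[M [_ MK]].
pose B := (M + 1)%R; have {}MK x : K x -> (`|x| <= B)%R by apply: MK; rewrite ltrDl.
(* One cube contains [K]; boxes are open on the left, hence the lower corner [- B - 1]. The other
   boxes are degenerate, with volume [0] because [p > 0]: in dimension [0] the empty product would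
   be [1]. *)
pose lu (j : nat) : 'rV[R]_p * 'rV[R]_p :=
  if j is 0%N then (const_mx (- B - 1)%R, const_mx B) else (0, 0)%R.
apply: (@le_lt_trans _ _ (box_volume (lu 0%N).1 (lu 0%N).2)%:E); last exact: ltry.
apply: ereal_inf_lbound; exists lu => /=.
  move=> x /MK xB; exists 0%N => // i; rewrite /= !mxE in_itv/=.
  have : (`|x ord0 i| <= B)%R.
    apply: le_trans xB; rewrite [leRHS]mx_normrE.
    by apply: (le_bigmax _ (fun ij => `|x ij.1 ij.2|)%R (ord0, i)).
  by rewrite ler_norml => /andP[h ->]; rewrite andbT (lt_le_trans _ h)// ltrBlDr ltrDl.
rewrite (nneseries_recl (P := xpredT))//; last first.
  by move=> k _; rewrite lee_fin prodr_ge0// => i _; rewrite le_max lexx orbT.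
rewrite eseries0 ?adde0// => -[|i]// _ _; rewrite /box_volume /=.
case: p p0 {K MK lu} => // p _.
by rewrite big_ord_recl !mxE subrr maxxx mul0r.
Qed.

Section constant.
Variables (R : realType) (p : nat) (K : set 'rV[R]_p) (c : R).
Hypothesis cE : p%:R%:E * lebesgue_rV K = c%:E.

Lemma Lfun_Lc a psi Q : Defs.Lfun K a psi Q = Lc a c p.-1 Q psi.
Proof. by rewrite /Defs.Lfun cE. Qed.

Lemma radial_hdens psi : radial K psi = hdens c p.-1 psi.
Proof. by apply/funext => r; rewrite /radial cE -EFinM. Qed.

End constant.

(* If [K] had outer measure 0, constants would make the functional unbounded, so
   the existence of a maximiser already gives positivity. *)
Lemma phi_star_constant (R : realType) (p : nat) (K : set 'rV[R]_p) (a : R)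
    (Q : probability (measurableTypeR R) R) (phi : R -> \bar R) :
  (0 < p)%N -> compact K -> Q `[a, +oo[%classic = 1 -> is_phi_star K a Q phi ->
  exists2 c : R, (0 < c)%R & p%:R%:E * lebesgue_rV K = c%:E.
Proof.
move=> p0 cK Qa [/Phi_fromP hphi hmax _].
have Kf : lebesgue_rV K \is a fin_num.
  by rewrite ge0_fin_numE ?lebesgue_rV_ge0 ?lebesgue_rV_lty.
pose c := (p%:R * fine (lebesgue_rV K))%R.
have cE : p%:R%:E * lebesgue_rV K = c%:E by rewrite EFinM fineK.
exists c => //; rewrite lt_neqAle; apply/andP; split; last first.
  by rewrite mulr_ge0// fine_ge0// lebesgue_rV_ge0.
apply/eqP => c0; have phiy := phi_on_integral_lty Q hphi.
have [x xphi] : exists x : R, \int[Q]_(r in `[a, +oo[) phi r < x%:E.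
  move: phiy; case: (integral _ _ _) => [y _|//|_]; last by exists 0%R; rewrite ltNyr.
  by exists (y + 1)%R; rewrite lte_fin ltrDl.
have := hmax (cst x%:E); rewrite !(Lfun_Lc cE) /Lc -c0 !mul0e.
move=> /(_ (proj2 (Phi_fromP a _) (phi_on_cst a x))).
rewrite leeD2rE// integral_cst//.
have -> : x%:E * (Q : set _ -> \bar R) `[a, +oo[%classic = x%:E.
  by rewrite -[RHS]mule1; congr (_ * _); exact: Qa.
by rewrite !sube0 leNgt xphi.
Qed.

Lemma Qclass_dilation (R : realType) (k a : R)
    (P Q : probability (measurableTypeR R) R) : (0 < k)%R -> (0 <= a)%R ->
  (forall A, measurable A -> P A = pushforward Q (dilation k) A) ->
  Qclass a Q -> Qclass (k * a) P.
Proof.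
move=> k0 a0 PQ [Qa Q1 Qa1]; have kN0 : k != 0%R by rewrite gt_eqF.
split.
- rewrite PQ; last exact: measurable_itv.
  by rewrite /pushforward dilation_preimage_itvcy// mulrAC divff// mul1r.
- rewrite (integral_dilation k0 PQ)//.
  under eq_integral do rewrite EFinM.
  rewrite integralZl_gt0//.
  move: Q1; case: (integral _ _ _) => [x _|//|_]; first by rewrite -EFinM ltry.
  by rewrite gt0_muleNy ?lte_fin.
- rewrite PQ; last exact: measurable_set1.
  have E : dilation k @^-1` [set (k * a)%R] = [set a].
    by apply/seteqP; split => x /=; rewrite /dilation; [move/(mulfI kN0)|move=> ->].
  by rewrite /pushforward E.
Qed.

(** [rescale] carries candidates on [[k * a, +oo[] to candidates on [[a, +oo[] and sends [phik] to
    [phi]; the functional changes by a constant, so maximality and uniqueness transfer. *)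
Lemma is_phi_star_dilation (R : realType) (p : nat) (K : set 'rV[R]_p)
    (k a c : R) (P Q : probability (measurableTypeR R) R) (phi : R -> \bar R) :
  (0 < p)%N -> (0 < k)%R -> (0 <= a)%R -> Q `[a, +oo[%classic = 1 ->
  (forall A, measurable A -> P A = pushforward Q (dilation k) A) ->
  p%:R%:E * lebesgue_rV K = c%:E ->
  is_phi_star K a Q phi ->
  is_phi_star K (k * a) P (fun r => phi (r / k)%R - (p%:R * ln k)%:E).
Proof.
move=> p0 k0 a0 Qa PQ cE [/Phi_fromP hphi hmax huniq].
have kN0 : k != 0%R by rewrite gt_eqF.
have pE : p = p.-1.+1 by rewrite prednK.
set phik := (X in is_phi_star _ _ _ X).
have ki0 : (0 < k^-1)%R by rewrite invr_gt0.
have hphik : phi_on (k * a) phik.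
  have := phi_on_scale ki0 hphi; rewrite invrK (mulrC a) => h.
  have := phi_onD h (phi_on_cst (k * a) (- (p%:R * ln k))).
  by apply: eq_phi_on => r _; rewrite /phik mulrC EFinN.
have resc psi : phi_on (k * a) psi -> Defs.Lfun K (k * a) psi P =
    Defs.Lfun K a (rescale k p.-1 psi) Q - (p%:R * ln k)%:E.
  by move=> hpsi; rewrite !(Lfun_Lc cE) (Lc_rescale c p.-1 a0 k0 PQ Qa hpsi) -pE.
have rphik r : rescale k p.-1 phik r = phi r.
  rewrite /rescale /phik -pE mulrAC divff// mul1r.
  by rewrite -addeA -EFinN -EFinD addNr adde0.
have Lphik : Defs.Lfun K a (rescale k p.-1 phik) Q = Defs.Lfun K a phi Q.
  by congr (Defs.Lfun _ _ _ _); apply/funext.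
split.
- exact/Phi_fromP.
- move=> psi /Phi_fromP hpsi; rewrite !resc// Lphik leeB//.
  by apply: hmax; apply/Phi_fromP; exact: phi_on_rescale.
- move=> psi /Phi_fromP hpsi; rewrite !resc// Lphik => E r ar.
  have hr : phi_on a (rescale k p.-1 psi) by exact: phi_on_rescale.
  have E' : Defs.Lfun K a (rescale k p.-1 psi) Q = Defs.Lfun K a phi Q.
    by move: E; move: (Defs.Lfun _ _ _ _) (Defs.Lfun _ _ _ _) => [x| |] [y| |]//;
      rewrite -!EFinB => -[/addIr ->].
  have ark : (a <= r / k)%R by rewrite ler_pdivlMr// mulrC.
  have := huniq _ (proj2 (Phi_fromP _ _) hr) E' _ ark.
  rewrite /rescale mulrCA divff// mulr1 -pE /phik => <-.
  by rewrite -addeA -EFinN -EFinD subrr adde0.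
Qed.

(** Uniqueness within [is_phi_star] makes the existential in (i) determine the projection. In (iv)
    the value of the difference where [phi_star = -oo] is immaterial: the density vanishes there and
    the set is [Q]-null. *)
Theorem proposition5 (R : realType) (p : nat) (hp : (0 < p)%N)
    (K : set 'rV[R]_p) (hK : convex_body0 K) (a : R) (ha : (0 <= a)%R)
    (Q : probability (measurableTypeR R) R) (hQ : Qclass a Q)
    (phi_star : R -> \bar R) (hphi : is_phi_star K a Q phi_star) :
  let h_star := radial K phi_star in
  [/\ (* (i) *)
      (forall (alpha : R) (Qalpha : probability (measurableTypeR R) R),
         (0 < alpha)%R ->
         (forall r : R, (alpha * a <= r)%R ->
            Qalpha `[(alpha * a)%R, r[%classic = Q `[a, (r / alpha)%R[%classic) ->
         Qclass (alpha * a) Qalpha /\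
         exists2 phi_alpha : R -> \bar R,
           is_phi_star K (alpha * a) Qalpha phi_alpha &
           forall r : R, (alpha * a <= r)%R ->
             phi_alpha r = phi_star (r / alpha)%R - (p%:R * ln alpha)%:E /\
             radial K phi_alpha r = (alpha^-1)%:E * h_star (r / alpha)%R),
      (* (ii) *)
      (forall Delta : R -> \bar R,
         (forall r : R, (a <= r)%R -> Delta r < +oo) ->
         (exists2 t : R, (0 < t)%R &
            Phi_from a (fun r => phi_star r + t%:E * Delta r)) ->
         \int[Q]_(r in `[a, +oo[) Delta r
           <= \int[lebesgue_measure]_(r in `[a, +oo[) (Delta r * h_star r)),
      (* (iii) *)
      \int[lebesgue_measure]_(r in `[a, +oo[) (r%:E * h_star r)
        <= \int[Q]_(r in `[a, +oo[) r%:E &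
      (* (iv) *)
      (forall phi0 : R -> \bar R,
         Phi_from a phi0 -> Hclass K a (radial K phi0) ->
         \int[lebesgue_measure]_(r in `[a, +oo[)
             (h_star r * (phi_star r - phi0 r))
           <= \int[Q]_(r in `[a, +oo[) (phi_star r - phi0 r))].
Proof.
move=> h_star; have [cK _ _] := hK; have [Qa Q1 _] := hQ.
have [c c0 cE] := phi_star_constant hp cK Qa hphi.
have [/Phi_fromP hps hmax _] := hphi.
have hmax' psi : phi_on a psi -> Lc a c p.-1 Q psi <= Lc a c p.-1 Q phi_star.
  by move=> /Phi_fromP /hmax; rewrite !(Lfun_Lc cE).
have hE : h_star = hdens c p.-1 phi_star by exact: radial_hdens.
split.
- move=> k P k0 PQ; have PQ' := probability_dilation k0 Qa PQ.
  split; first exact: (Qclass_dilation k0 ha PQ' hQ).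
  exists (fun r => phi_star (r / k)%R - (p%:R * ln k)%:E).
    exact: (is_phi_star_dilation hp k0 ha Qa PQ' cE hphi).
  move=> r kar; split => //; rewrite hE (radial_hdens cE) /hdens expeRD.
  (* Of the [p] factors [1 / k], all but one turn [r ^+ p.-1] into [(r / k) ^+ p.-1]; the last is
     the prefactor of the density. *)
  have kp : expR (p%:R * ln k) = (k * k ^+ p.-1)%R.
    by rewrite -exprS prednK// expRM_natl lnK// posrE.
  rewrite -EFinN -[expeR (- _)%:E]/((expR (- (p%:R * ln k)))%:E) expRN kp.
  rewrite (muleC (expeR _)) !muleA -!EFinM; congr (_%:E * _).
  by rewrite exprMn exprVn; field; rewrite ?gt_eqF ?exprn_gt0.
- move=> Delta Dy [t t0 /Phi_fromP hpsi]; rewrite hE.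
  exact: (variation ha c0 Qa Q1 hps hmax' t0 Dy hpsi).
- by rewrite hE; exact: (variation_mean ha c0 Qa Q1 hps hmax').
- move=> phi0 /Phi_fromP h0 _; rewrite hE.
  exact: (variation_entropy ha c0 Qa Q1 hps hmax' h0).
Qed.
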